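(* Let $\varepsilon>0$ be a constant and let $k=k_n$ be a sequence of integers such that eventually $\varepsilon\log n\le k\le n^{1/3-\varepsilon}$. Then there exists a sequence $m=m_n$ such that asymptotically almost surely $$\gamma(\mathcal{G}(n,m))=k \qquad\text{and}\qquad b(\mathcal{G}(n,m))=\Theta(\Delta(\mathcal{G}(n,m)))=\Theta(m/n).$$
   Context: $\mathcal{G}(n,m)$ denotes the random graph chosen uniformly at random among all graphs on vertex set $[n]=\{1,\dots,n\}$ with exactly $m$ edges (equivalently, the $m$-th graph of the Erdős–Rényi random graph process, which adds the edges of $K_n$ one at a time in a uniformly random order). A dominating set of a graph $G=(V,E)$ is a set $D\subseteq V$ such that every vertex not in $D$ has a neighbour in $D$; the domination number $\gamma(G)$ is the minimum size of a dominating set. The bondage number of a graph with at least one edge is $b(G)=\min\{|B|: B\subseteq E,\ \gamma(G-B)>\gamma(G)\}$. $\Delta(G)$ is the maximum degree. All logarithms are natural; asymptotics are as $n\to\infty$; ''eventually'' means for all but finitely many $n$; an event holds asymptotically almost surely (a.a.s.) if its probability tends to $1$. Functions hidden in $\Theta(\cdot)$ are positive. *)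

(* Defs.v *)
From HB Require Import structures.
From mathcomp Require Import all_boot all_order all_algebra.
From mathcomp Require Import all_classical all_reals all_analysis.

Set Implicit Arguments.
Unset Strict Implicit.
Unset Printing Implicit Defensive.

Import Order.TTheory GRing.Theory Num.Theory.
Import numFieldNormedType.Exports.

(* A graph on n vertices is given by its edge set E, which is meant to be a
   subset of [complete_graph n]; then no [set v; v] is in E, hence no loops. *)
Definition edge_set (n : nat) := {set {set 'I_n}}.

Definition complete_graph (n : nat) : edge_set n :=
  [set e : {set 'I_n} | #|e| == 2].

Definition adjv n (E : edge_set n) (u v : 'I_n) : bool :=
  [set u; v] \in E.

Definition vdegree n (E : edge_set n) (v : 'I_n) : nat :=
  #|[set u : 'I_n | adjv E v u]|.

Definition max_degree n (E : edge_set n) : nat :=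
  \max_(v : 'I_n) vdegree E v.

Definition dominating n (E : edge_set n) (D : {set 'I_n}) : bool :=
  [forall v, (v \notin D) ==> [exists u in D, adjv E v u]].

(* The default [set: 'I_n] is always dominating, so this is a true minimum. *)
Definition domination_number n (E : edge_set n) : nat :=
  #|[arg min_(D < [set: 'I_n] | dominating E D) #|D|]|.

(* The default B = E satisfies the condition as soon as the graph has an edge,
   so this is then a true minimum; it is 0 for the edgeless graph, where the
   bondage number is undefined. *)
Definition bondage_number n (E : edge_set n) : nat :=
  #|[arg min_(B < E | (B \subset E) &&
        (domination_number E < domination_number (E :\: B))%N) #|B|]|.

Definition graphs_with (n m : nat) : {set edge_set n} :=
  [set E : edge_set n | (E \subset complete_graph n) && (#|E| == m)].

Local Open Scope ring_scope.

(* Probability of P under G(n,m); it is 0 when m > 'C(n, 2), as there is then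
   no graph to choose from. *)
Definition prob_gnm (R : realType) (n m : nat) (P : pred (edge_set n)) : R :=
  #|[set E in graphs_with n m | P E]|%:R / #|graphs_with n m|%:R.

Definition aas (R : realType) (m : nat -> nat)
    (P : forall n, pred (edge_set n)) : Prop :=
  (prob_gnm R (m n) (P n) @[n --> \oo] --> (1 : R))%classic.

(* Main.v *)
(* The edge number m is chosen so that the expected number of dominating sets of
   size k - 1 tends to 0 while that of size k is exp(Theta(log^2 n)); there is room
   for this since the expectation grows by such a factor from k - 1 to k.

   Deleting the edges at both ends of an edge isolates two vertices, whence
   b <= 2 Delta. For the lower bound we show that a.a.s. every graph obtained by
   deleting at most c m / n edges still has a dominating k-set. Deleting B destroys
   a dominating set D only if, for some v outside D, all edges from v to D are in B.
   If v has at least c' log n neighbours in D, these edges share the blame, so an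
   edge at u destroys at most a 1 / (c' log n) fraction of the sets containing u,
   and these make up a k / n fraction of all of them for all but a few u, which is
   controlled by a second moment. The number of sets D containing u in which v has
   few neighbours is so small that Cauchy-Schwarz and its second moment, summed
   over all pairs (u, v), suffice. Both second moments need k^3 << n.

   These estimates are made in G(n,p); having a dominating k-set after any few
   deletions is an increasing property, having none of size k - 1 and having small
   maximum degree are decreasing ones, so they carry over to G(n,m) for m slightly
   above, respectively below, the mean number of edges. *)
Require Import Defs.
From HB Require Import structures.
From mathcomp Require Import all_boot all_order all_algebra.
From mathcomp Require Import all_classical all_reals all_analysis.
From mathcomp Require Import ring lra zify.
(* Again, because [classical_sets] shadows lemma names of these files. *)
From mathcomp Require Import fintype finset.

Set Implicit Arguments.
Unset Strict Implicit.
Unset Printing Implicit Defensive.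

Import Order.TTheory GRing.Theory Num.Theory.
Import numFieldNormedType.Exports.

Local Open Scope ring_scope.

(** * The binomial random subset *)

Section RandomSubset.
Variables (R : realFieldType) (T : finType) (p : R).
Implicit Types (U A B F E : {set T}) (f g : {set T} -> R).

Definition subset_weight U E : R := p ^+ #|E| * (1 - p) ^+ #|U :\: E|.

Definition Ex U f : R := \sum_(E : {set T} | E \subset U) subset_weight U E * f E.

(* [f E] only depends on [E :&: A]. *)
Definition local A f := forall E, f (E :&: A) = f E.

Lemma eq_Ex U f g : (forall E, E \subset U -> f E = g E) -> Ex U f = Ex U g.
Proof. by move=> fg; apply: eq_bigr => E /fg ->. Qed.

Lemma ExZ U c f : Ex U (fun E => c * f E) = c * Ex U f.
Proof. by rewrite /Ex mulr_sumr; apply: eq_bigr => E _; rewrite mulrCA. Qed.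

Lemma ExD U f g : Ex U (fun E => f E + g E) = Ex U f + Ex U g.
Proof. by rewrite /Ex -big_split; apply: eq_bigr => E _; rewrite mulrDr. Qed.

Lemma Ex_sum U (I : Type) (r : seq I) (P : pred I) (f : I -> {set T} -> R) :
  Ex U (fun E => \sum_(i <- r | P i) f i E) = \sum_(i <- r | P i) Ex U (f i).
Proof.
rewrite /Ex exchange_big; apply: eq_bigr => E _; by rewrite mulr_sumr.
Qed.

Lemma Ex_setU A B f : [disjoint A & B] ->
  Ex (A :|: B) f = Ex A (fun E => Ex B (fun E' => f (E :|: E'))).
Proof.
move=> dAB.
have disj E E' : E \subset A -> E' \subset B -> [disjoint E & E'].
  by move=> EA EB; apply: disjointWl EA _; apply: disjointWr EB _.
have capA E E' : E \subset A -> E' \subset B -> (E :|: E') :&: A = E.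
  move=> EA EB; rewrite setIUl (setIidPl EA).
  by rewrite (disjoint_setI0 _) ?setU0 // disjoint_sym (disj A E').
have capB E E' : E \subset A -> E' \subset B -> (E :|: E') :&: B = E'.
  move=> EA EB; rewrite setIUl (setIidPl EB).
  by rewrite (disjoint_setI0 _) ?set0U // (disj E B).
rewrite /Ex.
under [in RHS]eq_bigr => E _ do rewrite mulr_sumr.
rewrite pair_big /= (reindex_onto (fun X : {set T} * {set T} => X.1 :|: X.2)
  (fun E => (E :&: A, E :&: B))) /=; last first.
  by move=> E EU; rewrite -setIUr (setIidPl EU).
apply: eq_big => [[E E'] /=|[E E'] /= /andP[EA EB]].
  apply/andP/andP => [[_ /eqP[<- <-]]|[EA EB]]; first by rewrite !subsetIr.
  by rewrite capA // capB // setUSS // eqxx.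
have /andP[{}EA {}EB] : (E \subset A) && (E' \subset B).
  by case/eqP: EB => <- <-; rewrite !subsetIr.
rewrite /subset_weight.
have -> : (A :|: B) :\: (E :|: E') = (A :\: E) :|: (B :\: E').
  apply/setP => x; rewrite !inE; case xA: (x \in A).
    have xB : x \notin B by rewrite (disjointFr dAB).
    by rewrite (negPf xB) (contraNF (subsetP EB x) xB) orbF andbF !orbF andbT.
  by rewrite (contraFF (subsetP EA x) xA) andbF.
rewrite !cardsU !disjoint_setI0 ?cards0 ?subn0; last first.
- exact: disj.
- by apply: disjointWl (subsetDl _ _) _; apply: disjointWr (subsetDl _ _) _.
by rewrite !exprD; ring.
Qed.

Lemma Ex_set1 e f : Ex [set e] f = p * f [set e] + (1 - p) * f set0.
Proof.
rewrite /Ex (bigD1 [set e]) //= (bigD1 set0) /=; last first.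
  by rewrite sub0set eq_sym; apply/set0Pn; exists e; rewrite inE.
rewrite big1 => [|E /andP[/andP[]]]; last first.
  by rewrite subset1 => /orP[] ->.
by rewrite /subset_weight setDv setD0 cards0 cards1 !expr0 !expr1 mulr1 mul1r addr0.
Qed.

Lemma Ex_set0 f : Ex set0 f = f set0.
Proof.
rewrite /Ex (bigD1 set0) //= big1 ?addr0 => [|E].
  by rewrite /subset_weight setDv cards0 !expr0 !mul1r.
by rewrite subset0 => /andP[->].
Qed.

Lemma Ex_pow_card U x : Ex U (fun E => x ^+ #|E|) = (1 - p + p * x) ^+ #|U|.
Proof.
move: {2}#|U| (erefl #|U|) => n; elim: n U => [|n IH] U cU.
  by move/cards0_eq: (cU) ->; rewrite Ex_set0 cards0 !expr0.
have /card_gt0P[e eU] : (0 < #|U|)%N by rewrite cU.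
rewrite -(setD1K eU) Ex_setU ?disjoints1 ?inE ?eqxx // Ex_set1.
have cU' : #|U :\ e| = n by apply: succn_inj; rewrite -cU (cardsD1 e U) eU.
rewrite cardsU1 !inE eqxx /= add1n exprS.
rewrite -(IH _ cU') [RHS]mulrDl -mulrA [RHS]addrC; congr (_ * _ + _).
  rewrite -ExZ; apply: eq_Ex => E EU.
  rewrite cardsU1 -exprS; suff -> : e \notin E by [].
  by apply/negP => /(subsetP EU); rewrite !inE eqxx.
by congr (_ * _); apply: eq_Ex => E _; rewrite set0U.
Qed.

Lemma Ex_cst U c : Ex U (fun=> c) = c.
Proof.
rewrite (@eq_Ex _ _ (fun E => c * 1 ^+ #|E|)) => [|E _]; last first.
  by rewrite expr1n mulr1.
by rewrite ExZ Ex_pow_card mulr1 subrK expr1n mulr1.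
Qed.

Lemma Ex_local U A f : A \subset U -> local A f -> Ex U f = Ex A f.
Proof.
move=> AU fA; have dA : [disjoint A & U :\: A].
  by rewrite disjoints_subset setCD subsetUr.
have UE : U = A :|: U :\: A by rewrite -{1}(setID U A) (setIidPr AU).
rewrite {1}UE Ex_setU //; apply: eq_Ex => E EA.
rewrite -[RHS](Ex_cst (U :\: A) (f E)); apply: eq_Ex => E' E'A.
rewrite -fA setIUl (setIidPl EA) (@disjoint_setI0 _ E') ?setU0 //.
by apply: disjointWl E'A _; rewrite disjoint_sym.
Qed.

Lemma Ex_indep U A B f g : A \subset U -> B \subset U -> [disjoint A & B] ->
  local A f -> local B g -> Ex U (fun E => f E * g E) = Ex U f * Ex U g.
Proof.
move=> AU BU dAB fA gB.
have fgAB : local (A :|: B) (fun E => f E * g E).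
  move=> E; rewrite -(fA (E :&: _)) -(gB (E :&: _)) -!setIA.
  by rewrite !(setIC (A :|: B)) setKU (setUC A B) setKU fA gB.
rewrite (Ex_local _ fgAB) ?subUset ?AU // Ex_setU //.
rewrite (Ex_local AU fA) (Ex_local BU gB) mulrC -ExZ.
apply: eq_Ex => E EA; rewrite mulrC -ExZ; apply: eq_Ex => E' E'B.
rewrite -fA -gB !setIUl (setIidPl EA) (setIidPl E'B).
rewrite (@disjoint_setI0 _ E' A) ?(@disjoint_setI0 _ E B) ?setU0 ?set0U //.
- exact: disjointWl EA dAB.
- by apply: disjointWl E'B _; rewrite disjoint_sym.
Qed.

Lemma local_sub A B f : A \subset B -> local A f -> local B f.
Proof. by move=> AB fA E; rewrite -fA -setIA (setIidPr AB) fA. Qed.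

Lemma local_prod A (I : finType) (W : {set I}) (f : I -> {set T} -> R) :
  (forall i, i \in W -> local A (f i)) ->
  local A (fun E => \prod_(i in W) f i E).
Proof. by move=> fA E; apply: eq_bigr => i iW; apply: fA. Qed.

Lemma Ex_prod U (I : finType) (W : {set I}) (F : I -> {set T})
    (f : I -> {set T} -> R) :
  (forall i, i \in W -> F i \subset U) ->
  {in W &, forall i j, i != j -> [disjoint F i & F j]} ->
  (forall i, i \in W -> local (F i) (f i)) ->
  Ex U (fun E => \prod_(i in W) f i E) = \prod_(i in W) Ex U (f i).
Proof.
move: {2}#|W| (erefl #|W|) => n; elim: n W => [|n IH] W cW FU dF fF.
  move/cards0_eq: (cW) ->; rewrite big_set0.
  by rewrite -[RHS](Ex_cst U); apply: eq_Ex => E _; rewrite big_set0.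
have /card_gt0P[i iW] : (0 < #|W|)%N by rewrite cW.
rewrite (big_setD1 i iW) /=.
rewrite (@eq_Ex _ _ (fun E => f i E * \prod_(j in W :\ i) f j E)) => [|E _]; last first.
  by rewrite (big_setD1 i iW).
have WiW : W :\ i \subset W by apply: subsetDl.
have cW' : #|W :\ i| = n by apply: succn_inj; rewrite -cW (cardsD1 i W) iW.
rewrite (@Ex_indep _ (F i) (\bigcup_(j in W :\ i) F j)).
- rewrite IH // => [j /(subsetP WiW)|j k /(subsetP WiW) jW /(subsetP WiW) kW|j /(subsetP WiW)].
  + exact: FU.
  + exact: dF.
  + exact: fF.
- exact: FU.
- by apply/bigcupsP => j /(subsetP WiW); exact: FU.
- apply/bigcup_disjointP => j /setD1P[ji jW].
  by apply: dF => //; rewrite eq_sym.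
- exact: fF.
- apply: local_prod => j jW; apply: (local_sub (A := F j)); first exact: bigcup_sup.
  by apply: fF; apply: (subsetP WiW).
Qed.

Lemma Ex_pow U F x : F \subset U ->
  Ex U (fun E => x ^+ #|E :&: F|) = (1 - p + p * x) ^+ #|F|.
Proof.
move=> FU; rewrite (Ex_local FU) => [|E]; last by rewrite -setIA setIid.
rewrite -Ex_pow_card; apply: eq_Ex => E EF; by rewrite (setIidPl EF).
Qed.

Hypothesis p01 : 0 <= p <= 1.

Lemma subset_weight_ge0 U E : 0 <= subset_weight U E.
Proof. by case/andP: p01 => p0 p1; rewrite mulr_ge0 // exprn_ge0 // subr_ge0. Qed.

Lemma le_Ex U f g : (forall E, E \subset U -> f E <= g E) -> Ex U f <= Ex U g.
Proof.
by move=> fg; apply: ler_sum => E EU; rewrite ler_wpM2l ?subset_weight_ge0 ?fg.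
Qed.

Definition Pr U (P : pred {set T}) : R := Ex U (fun E => (P E)%:R).

Lemma le_Pr U (P Q : pred {set T}) :
  (forall E, E \subset U -> P E -> Q E) -> Pr U P <= Pr U Q.
Proof.
move=> PQ; apply: le_Ex => E EU; rewrite ler_nat.
by case: (P E) (PQ E EU) => // ->.
Qed.

Lemma markov_Ex U f (a : R) (P : pred {set T}) : 0 < a ->
  (forall E, E \subset U -> 0 <= f E) ->
  (forall E, E \subset U -> P E -> a <= f E) -> Pr U P <= Ex U f / a.
Proof.
move=> a0 f0 Pf; rewrite mulrC -ExZ; apply: le_Ex => E EU.
rewrite ler_pdivlMl //; case: (boolP (P E)) => [PE|_]; first by rewrite mulr1 Pf.
by rewrite mulr0 f0.
Qed.

Lemma Pr_predC U (P : pred {set T}) : Pr U (predC P) = 1 - Pr U P.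
Proof.
apply/eqP; rewrite eq_sym subr_eq /Pr -ExD; apply/eqP.
rewrite -[LHS](Ex_cst U 1); apply: eq_Ex => E _ /=.
by case: (P E); rewrite /= ?add0r ?addr0.
Qed.

Lemma Pr_predU U (P Q : pred {set T}) : Pr U (predU P Q) <= Pr U P + Pr U Q.
Proof.
rewrite /Pr -ExD; apply: le_Ex => E _ /=.
by case: (P E); case: (Q E); rewrite /= -natrD ler_nat.
Qed.

End RandomSubset.

(** * Domination probabilities *)

Lemma ler_natb (R : numDomainType) (b b' : bool) : (b -> b') -> b%:R <= b'%:R :> R.
Proof. by rewrite ler_nat; case: b => // ->. Qed.

Section Stars.
Variables (n : nat).
Implicit Types (E : edge_set n) (D W : {set 'I_n}) (u v : 'I_n).

Definition star D v : edge_set n := [set [set u; v] | u in D].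

Lemma star_inj v : {in [pred u | u != v] &, injective (fun u => [set u; v])}.
Proof.
move=> u w uv wv /setP /(_ u); rewrite !inE eqxx (negPf uv) /= orbF.
by move/esym/eqP.
Qed.

Lemma card_star D v : v \notin D -> #|star D v| = #|D|.
Proof.
move=> vD; apply: card_in_imset => u w uD wD; apply: star_inj; rewrite inE.
  by apply: contraNneq vD => <-.
by apply: contraNneq vD => <-.
Qed.

Lemma star_complete D v : v \notin D -> star D v \subset complete_graph n.
Proof.
move=> vD; apply/subsetP => e /imsetP[u uD ->]; rewrite inE cards2.
by rewrite (_ : u != v) //; apply: contraNneq vD => <-.
Qed.

Lemma disjoint_star D v w : v \notin D -> w \notin D -> v != w ->
  [disjoint star D v & star D w].
Proof.
move=> vD wD vw; apply/pred0P => e /=; apply/negP => /andP[].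
move=> /imsetP[u uD ->] /imsetP[z zD] /setP /(_ v).
rewrite !inE eqxx orbT (negPf vw) orbF => /esym/eqP vz.
by move: vD; rewrite vz zD.
Qed.

Lemma starU D D' v : star (D :|: D') v = star D v :|: star D' v.
Proof. exact: imsetU. Qed.

Definition dominated E D v : bool := E :&: star D v != set0.

Lemma mem_star E D v u : v \notin D ->
  ([set u; v] \in E :&: star D v) = ([set u; v] \in E) && (u \in D).
Proof.
move=> vD; rewrite inE; case: ([set u; v] \in E) => //=.
apply/imsetP/idP => [[w wD /setP /(_ w)]|uD]; last by exists u.
rewrite !inE eqxx /= => /orP[/eqP <- //|/eqP wv].
by rewrite wv (negPf vD) in wD.
Qed.

Lemma dominatedP E D v : v \notin D ->
  dominated E D v = [exists u in D, adjv E v u].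
Proof.
move=> vD; apply/set0Pn/existsP => [[e]|[u /andP[uD]]].
  move=> eES; move: (eES); rewrite inE => /andP[_ /imsetP[u uD eE]].
  by exists u; rewrite uD /adjv setUC; move: eES; rewrite eE mem_star // => /andP[].
by rewrite /adjv setUC => uvE; exists [set u; v]; rewrite mem_star // uvE.
Qed.

Lemma dominatingE E D : dominating E D = [forall v in ~: D, dominated E D v].
Proof.
apply: eq_forallb => v; rewrite inE; case: (boolP (v \in D)) => //= vD.
by rewrite dominatedP.
Qed.

(* Ignoring [v] makes this event independent of the edges at [v]. *)
Definition dominating_but E D v : bool :=
  [forall w in ~: (v |: D), dominated E D w].

Lemma dominating_butW E D v : dominating E D -> dominating_but E D v.
Proof.
rewrite dominatingE => /forallP h; apply/forallP => w; apply/implyP.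
by rewrite !inE negb_or => /andP[_ wD]; apply: (implyP (h w)); rewrite inE.
Qed.

Variable R : realFieldType.

Lemma natr_forall (I : finType) (W : {set I}) (P : pred I) :
  ([forall i in W, P i])%:R = \prod_(i in W) (P i)%:R :> R.
Proof.
case: (boolP [forall i in W, P i]) => [/forallP h|].
  by rewrite big1 // => i iW; rewrite (implyP (h i) iW).
rewrite negb_forall => /existsP[i]; rewrite negb_imply => /andP[iW Pi].
by rewrite (bigD1 i iW) /= (negPf Pi) mul0r.
Qed.

Lemma natr_dominated E D v :
  (dominated E D v)%:R = 1 - 0 ^+ #|E :&: star D v| :> R.
Proof.
by rewrite /dominated -cards_eq0 expr0n; case: (_ == _); rewrite ?subrr ?subr0.
Qed.

Lemma dominated_local E (A : edge_set n) D v : star D v \subset A ->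
  dominated (E :&: A) D v = dominated E D v.
Proof. by move=> DA; rewrite /dominated -setIA (setIidPr DA). Qed.

Lemma local_dominated D v : local (star D v) (fun E => (dominated E D v)%:R : R).
Proof. by move=> E; rewrite /dominated -setIA setIid. Qed.

Variable p : R.
Let U := complete_graph n.

Lemma Ex_dominated D v : v \notin D ->
  Ex p U (fun E => (dominated E D v)%:R) = 1 - (1 - p) ^+ #|D|.
Proof.
move=> vD; rewrite (@eq_Ex _ _ _ _ _ (fun E => 1 + -1 * 0 ^+ #|E :&: star D v|)).
  rewrite ExD Ex_cst ExZ Ex_pow ?star_complete // card_star //.
  by rewrite mulr0 addr0 mulN1r.
by move=> E _; rewrite natr_dominated mulN1r.
Qed.

Lemma Ex_dominating D :
  Ex p U (fun E => (dominating E D)%:R) = (1 - (1 - p) ^+ #|D|) ^+ (n - #|D|).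
Proof.
rewrite (@eq_Ex _ _ _ _ _ (fun E => \prod_(v in ~: D) (dominated E D v)%:R)).
  rewrite (@Ex_prod _ _ p _ _ _ (star D)).
  - rewrite (eq_bigr (fun=> 1 - (1 - p) ^+ #|D|)) => [|v]; last first.
      by rewrite inE => vD; apply: Ex_dominated.
    by rewrite prodr_const (cardsCs (~: D)) setCK card_ord.
  - by move=> v; rewrite inE => vD; apply: star_complete.
  - by move=> v w; rewrite !inE => vD wD; apply: disjoint_star.
  - by move=> v _; apply: local_dominated.
by move=> E _; rewrite dominatingE natr_forall.
Qed.

Variable k : nat.

(* The probability that a vertex outside two [k]-sets sharing [i] vertices is
   dominated by both of them. *)
Definition pair_factor (i : nat) : R := 1 - 2 * (1 - p) ^+ k + (1 - p) ^+ (2 * k - i).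

Lemma Ex_dominated2 D D' v : v \notin D :|: D' -> #|D| = k -> #|D'| = k ->
  Ex p U (fun E => (dominated E D v)%:R * (dominated E D' v)%:R)
  = pair_factor #|D :&: D'|.
Proof.
move=> vDD cD cD'; have /norP[vD vD'] : ~~ ((v \in D) || (v \in D')) by rewrite -in_setU.
rewrite (@eq_Ex _ _ _ _ _ (fun E => 1 + (-1 * 0 ^+ #|E :&: star D v| +
  (-1 * 0 ^+ #|E :&: star D' v| + 0 ^+ #|E :&: star (D :|: D') v|)))).
  rewrite !ExD Ex_cst !ExZ !Ex_pow ?star_complete // !card_star //.
  rewrite mulr0 addr0 cD cD' cardsU cD cD' /pair_factor mul2n -addnn; ring.
move=> E _; rewrite !natr_dominated.
have -> : 0 ^+ #|E :&: star (D :|: D') v| =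
   0 ^+ #|E :&: star D v| * 0 ^+ #|E :&: star D' v| :> R.
  rewrite -exprD !expr0n addn_eq0 !cards_eq0 starU setIUr.
  by congr (_%:R); congr nat_of_bool; rewrite setU_eq0.
by move: (0 ^+ _) (0 ^+ _) => a b; ring.
Qed.

Hypothesis p01 : 0 <= p <= 1.

Lemma Ex_dominating2 D D' : #|D| = k -> #|D'| = k ->
  Ex p U (fun E => (dominating E D)%:R * (dominating E D')%:R)
  <= pair_factor #|D :&: D'| ^+ (n - (2 * k - #|D :&: D'|)).
Proof.
move=> cD cD'; pose W := ~: (D :|: D').
have cW : #|W| = (n - (2 * k - #|D :&: D'|))%N.
  by rewrite /W cardsCs setCK card_ord cardsU cD cD' mul2n -addnn.
apply: (@le_trans _ _ (Ex p U (fun E => \prod_(v in W)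
    ((dominated E D v)%:R * (dominated E D' v)%:R)))).
  apply: le_Ex => // E _; rewrite !dominatingE big_split /= -!natr_forall.
  rewrite -!natrM !mulnb; apply: ler_natb.
  case/andP=> /forallP h /forallP h'; apply/andP; split; apply/forallP => v;
    apply/implyP; rewrite !inE negb_or => /andP[vD vD'].
    by apply: (implyP (h v)); rewrite inE.
  by apply: (implyP (h' v)); rewrite inE.
rewrite (@Ex_prod _ _ p _ _ _ (star (D :|: D'))).
- rewrite (eq_bigr (fun=> pair_factor #|D :&: D'|)) => [|v]; last first.
    by rewrite inE => vD; apply: Ex_dominated2.
  by rewrite prodr_const cW.
- by move=> v; rewrite inE => vD; apply: star_complete.
- by move=> v w; rewrite !inE => vD wD; apply: disjoint_star; rewrite !inE.
- move=> v _ E; by rewrite !dominated_local // starU ?subsetUl ?subsetUr.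
Qed.

Lemma Ex_weak2 x D D' v : 0 <= x <= 1 -> v \notin D :|: D' -> #|D| = k -> #|D'| = k ->
  Ex p U (fun E => ((dominating_but E D v)%:R * x ^+ #|E :&: star D v|) *
     ((dominating_but E D' v)%:R * x ^+ #|E :&: star D' v|))
  <= (1 - p + p * x) ^+ (2 * k - #|D :&: D'|) *
     pair_factor #|D :&: D'| ^+ (n - (2 * k - #|D :&: D'|)).-1.
Proof.
move=> /andP[x0 x1] vDD cD cD'; pose W := ~: (D :|: D').
have cDU : #|D :|: D'| = (2 * k - #|D :&: D'|)%N by rewrite cardsU cD cD' mul2n -addnn.
have cW : #|W| = (n - (2 * k - #|D :&: D'|))%N.
  by rewrite /W cardsCs setCK card_ord cDU.
have vW : v \in W by rewrite inE.
pose f w E : R := if w == v then x ^+ #|E :&: star (D :|: D') v| else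
   (dominated E D w)%:R * (dominated E D' w)%:R.
apply: (@le_trans _ _ (Ex p U (fun E => \prod_(w in W) f w E))).
  apply: le_Ex => // E _; rewrite (big_setD1 v vW) /= {1}/f eqxx.
  rewrite mulrACA [leLHS]mulrC; apply: ler_pM.
  - by rewrite mulr_ge0 // exprn_ge0.
  - by rewrite mulr_ge0.
  - rewrite -exprD ler_wiXn2l // starU setIUr.
    by rewrite cardsU leq_subr.
  rewrite (eq_bigr (fun w => (dominated E D w)%:R * (dominated E D' w)%:R)); last first.
    by move=> w /setD1P[wv _]; rewrite /f (negPf wv).
  rewrite big_split /= -!natr_forall -!natrM !mulnb; apply: ler_natb.
  case/andP=> /forallP h /forallP h'; apply/andP; split; apply/forallP => w;
    apply/implyP; rewrite !inE negb_or => /and3P[wv wD wD'].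
    by apply: (implyP (h w)); rewrite !inE negb_or wv.
  by apply: (implyP (h' w)); rewrite !inE negb_or wv.
rewrite (@Ex_prod _ _ p _ _ _ (star (D :|: D'))).
- rewrite (big_setD1 v vW) /= [f v]/f.
  rewrite (@eq_Ex _ _ _ _ _ (fun E => x ^+ #|E :&: star (D :|: D') v|)); last first.
    by move=> E _; rewrite /f eqxx.
  rewrite Ex_pow ?star_complete // card_star // cDU.
  rewrite (eq_bigr (fun=> pair_factor #|D :&: D'|)) => [|w /setD1P[wv]]; last first.
    rewrite inE => wW; rewrite -(@Ex_dominated2 D D' w) //.
    by apply: eq_Ex => E _; rewrite /f (negPf wv).
  by rewrite prodr_const -cW (cardsD1 v W) vW.
- by move=> w; rewrite inE => wD; apply: star_complete.
- by move=> w z; rewrite !inE => vD wD; apply: disjoint_star; rewrite !inE.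
- move=> w _ E; rewrite /f; case: eqP => [->|_]; first by rewrite -setIA setIid.
  by rewrite !dominated_local // starU ?subsetUl ?subsetUr.
Qed.

End Stars.

Section SecondMoment.
Variables (n k : nat) (R : realFieldType) (p : R).
Hypothesis p01 : 0 <= p <= 1.
Implicit Types (E : edge_set n) (D I : {set 'I_n}) (u v : 'I_n).
Let U := complete_graph n.

Definition dom_count u E : R :=
  \sum_(D : {set 'I_n} | (#|D| == k) && (u \in D)) (dominating E D)%:R.

(* The weight [x ^+ #|N(v) :&: D|] is a smooth substitute for the indicator of
   [v] having few neighbours in [D]; unlike the latter it factorizes over the
   edges at [v]. *)
Definition weak_count x u v E : R :=
  \sum_(D : {set 'I_n} | (#|D| == k) && ((u \in D) && (v \notin D)))
    (dominating_but E D v)%:R * x ^+ #|E :&: star D v|.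

Definition dom_prob : R := (1 - (1 - p) ^+ k) ^+ (n - k).

Lemma sum_common_vertex (G : {set 'I_n} -> {set 'I_n} -> R) :
  \sum_u \sum_(D : {set 'I_n} | (#|D| == k) && (u \in D))
    \sum_(D' : {set 'I_n} | (#|D'| == k) && (u \in D')) G D D' =
  \sum_(D : {set 'I_n} | #|D| == k) \sum_(D' : {set 'I_n} | #|D'| == k)
    #|D :&: D'|%:R * G D D'.
Proof.
rewrite (exchange_big_dep (fun D : {set 'I_n} => #|D| == k)) /=; last first.
  by move=> u D _ /andP[].
apply: eq_bigr => D kD.
rewrite (exchange_big_dep (fun D : {set 'I_n} => #|D| == k)) /=; last first.
  by move=> u D' _ /andP[].
apply: eq_bigr => D' kD'.
rewrite (eq_bigl (mem (D :&: D'))) => [|u]; last first.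
  by rewrite kD kD' /= in_setI.
by rewrite sumr_const mulr_natl.
Qed.

Lemma card_supersets I : (#|I| <= k)%N ->
  #|[set D : {set 'I_n} | (#|D| == k) && (I \subset D)]| = 'C(n - #|I|, k - #|I|).
Proof.
move=> Ik.
have -> : (n - #|I|)%N = #|~: I| by rewrite (cardsCs (~: I)) setCK card_ord.
rewrite -cards_draws.
rewrite -[RHS](@card_in_imset _ _ (fun A => A :|: I)); last first.
  move=> A B; rewrite !inE => /andP[AI _] /andP[BI _] /setP eqAB.
  apply/setP => x; move: (eqAB x) (subsetP AI x) (subsetP BI x); rewrite !inE.
  by case: (x \in I); rewrite ?orbF // !orbT; case: (x \in A) => //;
    case: (x \in B) => // _ h1 h2; first [have := h1 isT | have := h2 isT].
apply: eq_card => D; rewrite inE; apply/andP/imsetP.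
  case=> /eqP kD ID; exists (D :\: I); last first.
    by rewrite setUC setDE setUIr setUCr setIT (setUidPr ID).
  rewrite inE setDE subsetIr /=.
  by rewrite -setDE cardsD (setIidPr ID) kD.
case=> A; rewrite inE => /andP[AI /eqP cA] ->; rewrite subsetUr; split=> //.
rewrite cardsU cA (disjoint_setI0 _) ?cards0 ?subn0 ?subnK //.
by rewrite -[I]setCK -subsets_disjoint.
Qed.

Lemma pair_factor_ge i : (i <= k)%N -> (1 - (1 - p) ^+ k) ^+ 2 <= pair_factor p k i.
Proof.
case/andP: p01 => p0 p1 ik; have r0 : 0 <= 1 - p by rewrite subr_ge0.
have r1 : 1 - p <= 1 by rewrite gerBl.
have : (1 - p) ^+ (2 * k) <= (1 - p) ^+ (2 * k - i).
  by apply: ler_wiXn2l => //; apply: leq_subr.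
rewrite /pair_factor mulnC exprM; lra.
Qed.

Lemma pair_factor_ge0 i : (i <= k)%N -> 0 <= pair_factor p k i.
Proof. by move=> ik; apply: le_trans (pair_factor_ge ik); apply: sqr_ge0. Qed.

Lemma Ex_dom_count_variance : (0 < k)%N ->
  Ex p U (fun E => \sum_u (dom_count u E - 'C(n.-1, k.-1)%:R * dom_prob) ^+ 2)
  <= \sum_(D : {set 'I_n} | #|D| == k) \sum_(D' : {set 'I_n} | #|D'| == k)
    #|D :&: D'|%:R *
    (pair_factor p k #|D :&: D'| ^+ (n - (2 * k - #|D :&: D'|)) - dom_prob ^+ 2).
Proof.
move=> k0.
have dom_countB u E : dom_count u E - 'C(n.-1, k.-1)%:R * dom_prob =
    \sum_(D : {set 'I_n} | (#|D| == k) && (u \in D))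
      ((dominating E D)%:R - dom_prob).
  rewrite big_split /= sumr_const mulNrn mulr_natl; congr (_ - _ *+ _).
  have := @card_supersets [set u]; rewrite cards1 !subn1 => <- //.
  by apply: eq_card => D; rewrite !inE sub1set unfold_in /=.
rewrite (@eq_Ex _ _ _ _ _ (fun E => \sum_(D : {set 'I_n} | #|D| == k)
   \sum_(D' : {set 'I_n} | #|D'| == k) #|D :&: D'|%:R *
   (((dominating E D)%:R - dom_prob) * ((dominating E D')%:R - dom_prob)))); last first.
  move=> E _; rewrite -sum_common_vertex; apply: eq_bigr => u _.
  rewrite dom_countB expr2 mulr_suml; apply: eq_bigr => D _.
  by rewrite mulr_sumr.
rewrite Ex_sum; apply: ler_sum => D /eqP kD.
rewrite Ex_sum; apply: ler_sum => D' /eqP kD'.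
rewrite ExZ; apply: ler_wpM2l => //.
rewrite (@eq_Ex _ _ _ _ _ (fun E => (dominating E D)%:R * (dominating E D')%:R
   + ((- dom_prob) * (dominating E D')%:R + ((- dom_prob) * (dominating E D)%:R
   + dom_prob ^+ 2)))); last first.
  by move=> E _; move: dom_prob (_%:R) (_%:R) => a b c; ring.
rewrite !ExD !ExZ Ex_cst !Ex_dominating kD kD' -/dom_prob.
have := @Ex_dominating2 n R p k p01 D D' kD kD'.
rewrite -/U; move: (Ex _ _ _) (_ ^+ (n - _)%N) dom_prob => a b c; lra.
Qed.

Lemma Ex_weak_count x : 0 <= x <= 1 ->
  Ex p U (fun E => \sum_u \sum_v weak_count x u v E ^+ 2)
  <= \sum_(D : {set 'I_n} | #|D| == k) \sum_(D' : {set 'I_n} | #|D'| == k)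
    #|D :&: D'|%:R * (n%:R * ((1 - p + p * x) ^+ (2 * k - #|D :&: D'|) *
     pair_factor p k #|D :&: D'| ^+ (n - (2 * k - #|D :&: D'|)).-1)).
Proof.
move=> x01; case/andP: (x01) => x0 x1; case/andP: (p01) => p0 p1.
pose G E v D : R := (dominating_but E D v)%:R * x ^+ #|E :&: star D v|.
rewrite (@eq_Ex _ _ _ _ _ (fun E => \sum_(D : {set 'I_n} | #|D| == k)
   \sum_(D' : {set 'I_n} | #|D'| == k) #|D :&: D'|%:R *
   \sum_(v in ~: (D :|: D')) (G E v D * G E v D'))); last first.
  move=> E _; rewrite -sum_common_vertex; apply: eq_bigr => u _.
  have weakE v : weak_count x u v E =
      \sum_(D : {set 'I_n} | (#|D| == k) && (u \in D)) if v \notin D then G E v D else 0.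
    by rewrite -big_mkcondr; apply: eq_bigl => D; rewrite andbA.
  transitivity (\sum_v \sum_(D : {set 'I_n} | (#|D| == k) && (u \in D))
    \sum_(D' : {set 'I_n} | (#|D'| == k) && (u \in D'))
    if v \in ~: (D :|: D') then G E v D * G E v D' else 0).
    apply: eq_bigr => v _; rewrite weakE expr2 mulr_suml; apply: eq_bigr => D _.
    rewrite mulr_sumr; apply: eq_bigr => D' _; rewrite !inE negb_or.
    by case: (v \in D); case: (v \in D'); rewrite /= ?mulr0 ?mul0r.
  rewrite exchange_big /=; apply: eq_bigr => D _.
  by rewrite exchange_big /=; apply: eq_bigr => D' _; rewrite -big_mkcond.
rewrite Ex_sum; apply: ler_sum => D /eqP kD.
rewrite Ex_sum; apply: ler_sum => D' /eqP kD'.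
rewrite ExZ; apply: ler_wpM2l => //.
rewrite Ex_sum; have ik : (#|D :&: D'| <= k)%N.
  by rewrite -kD subset_leq_card // subsetIl.
apply: (@le_trans _ _ (\sum_(v in ~: (D :|: D'))
   ((1 - p + p * x) ^+ (2 * k - #|D :&: D'|) *
     pair_factor p k #|D :&: D'| ^+ (n - (2 * k - #|D :&: D'|)).-1))).
  apply: ler_sum => v; rewrite inE => vDD; exact: Ex_weak2.
rewrite sumr_const -[leLHS]mulr_natl; apply: ler_wpM2r.
  rewrite mulr_ge0 ?exprn_ge0 ?pair_factor_ge0 //.
  by rewrite addr_ge0 ?subr_ge0 // mulr_ge0.
by rewrite ler_nat -[leqRHS]card_ord max_card.
Qed.

End SecondMoment.

(** * Deterministic facts on domination and bondage *)

Section Deterministic.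
Variable n : nat.
Implicit Types (E B : edge_set n) (D : {set 'I_n}) (u v : 'I_n).

Definition has_dominating k E : bool := [exists D : {set 'I_n}, (#|D| == k) && dominating E D].

Definition robustly_dominated k t E : bool :=
  [forall B : edge_set n, (#|B| <= t)%N ==> has_dominating k (E :\: B)].

Lemma mem_complete (e : {set 'I_n}) : (e \in complete_graph n) = (#|e| == 2).
Proof. by rewrite inE. Qed.

Lemma dominatingT E : dominating E [set: 'I_n].
Proof. by apply/forallP => v; rewrite inE. Qed.

Lemma dominatingS E E' D D' : E \subset E' -> D \subset D' ->
  dominating E D -> dominating E' D'.
Proof.
move=> EE' DD' /forallP dED; apply/forallP => v; apply/implyP => vD'.
have vD : v \notin D by apply: contraNN vD' => /(subsetP DD').
case/existsP: (implyP (dED v) vD) => u /andP[uD uvE].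
by apply/existsP; exists u; rewrite (subsetP DD') //= /adjv (subsetP EE').
Qed.

Lemma domination_number_le E D : dominating E D -> (domination_number E <= #|D|)%N.
Proof.
by rewrite /domination_number; case: arg_minnP; [exact: dominatingT|move=> D0 _; apply].
Qed.

Lemma domination_number_attained E :
  exists2 D, dominating E D & #|D| = domination_number E.
Proof.
rewrite /domination_number; case: arg_minnP; first exact: dominatingT.
by move=> D dD _; exists D.
Qed.

Lemma domination_number_empty : domination_number (set0 : edge_set n) = n.
Proof.
case: (domination_number_attained set0) => D dD <-.
suff -> : D = [set: 'I_n] by rewrite cardsT card_ord.
apply/setP => v; rewrite inE; apply/negbNE/negP => vD.
case/existsP: (implyP (forallP dD v) vD) => u /andP[_].
by rewrite /adjv inE.
Qed.

Lemma extend_set D k : (#|D| <= k <= n)%N -> exists2 D' : {set 'I_n}, D \subset D' & #|D'| = k.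
Proof.
move=> /andP[]; move: {2}(k - #|D|)%N (erefl (k - #|D|)%N) => d.
elim: d D => [|d IH] D dD Dk kn.
  by exists D => //; apply/eqP; rewrite eqn_leq Dk -subn_eq0 dD.
have /card_gt0P[v] : (0 < #|~: D|)%N by rewrite cardsCs setCK card_ord; lia.
rewrite inE => vD; have cvD : #|v |: D| = #|D|.+1 by rewrite cardsU1 vD.
case: (IH (v |: D)); rewrite ?cvD; try lia.
move=> D' vDD' cD'; exists D' => //; apply: subset_trans vDD'.
exact: subsetUr.
Qed.

Lemma domination_numberE k E : (0 < k <= n)%N ->
  has_dominating k E -> ~~ has_dominating k.-1 E -> domination_number E = k.
Proof.
move=> /andP[k0 kn] /existsP[D /andP[/eqP cD dD]] nd; apply/eqP; rewrite eqn_leq.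
rewrite -{1}cD domination_number_le //= leqNgt; apply: contra nd => lt.
case: (domination_number_attained E) => D' dD' cD'.
case: (@extend_set D' k.-1) => [|D'' sD cD'']; first by rewrite cD'; lia.
by apply/existsP; exists D''; rewrite cD'' eqxx (dominatingS _ sD dD').
Qed.

Lemma bondage_number_spec E : (domination_number E < n)%N ->
  exists2 B : edge_set n, (B \subset E) && (domination_number E < domination_number (E :\: B))%N
    & #|B| = bondage_number E.
Proof.
move=> ltn; rewrite /bondage_number; case: arg_minnP.
  by rewrite subxx setDv domination_number_empty.
by move=> B hB _; exists B.
Qed.

Lemma bondage_number_gt k t E : (k < n)%N -> domination_number E = k ->
  robustly_dominated k t E -> (t < bondage_number E)%N.
Proof.
move=> kn dE rob; case: (bondage_number_spec (E := E)); first by rewrite dE.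
move=> B /andP[_ ltB] <-; rewrite ltnNge; apply/negP => Bt.
case/existsP: (implyP (forallP rob B) Bt) => D /andP[/eqP cD /domination_number_le].
by rewrite leqNgt cD -dE ltB.
Qed.

Lemma card_incident E v : E \subset complete_graph n ->
  (#|[set e in E | v \in e]| <= max_degree E)%N.
Proof.
move=> EU; apply: leq_trans (leq_bigmax v); rewrite /vdegree.
apply: leq_trans (leq_imset_card (fun u => [set v; u]) _).
apply/subset_leq_card/subsetP => e; rewrite inE => /andP[eE ve].
have := subsetP EU e eE; rewrite mem_complete => /cards2P[a [b [ab eab]]].
move: ve; rewrite eab !inE => /orP[]/eqP ->; apply/imsetP.
  by exists b; rewrite // inE /adjv -eab.
by exists a; rewrite ?inE /adjv setUC -?eab // setUC.
Qed.

(* Isolating the two ends [u], [v] of an edge forces both into every dominating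
   set, while [u] alone takes care of [v] in the original graph. *)
Lemma bondage_number_le E : E \subset complete_graph n -> (0 < #|E|)%N ->
  (bondage_number E <= 2 * max_degree E)%N.
Proof.
move=> EU /card_gt0P[e eE]; have := subsetP EU e eE; rewrite mem_complete => /cards2P[u [v [uv euv]]].
pose B := [set e in E | u \in e] :|: [set e in E | v \in e].
have cB : (#|B| <= 2 * max_degree E)%N.
  rewrite mul2n -addnn (leq_trans (leq_card_setU _ _)) //.
  by rewrite leq_add // card_incident.
apply: leq_trans cB; rewrite /bondage_number; case: arg_minnP.
- rewrite subxx setDv domination_number_empty /=.
  have := @domination_number_le E [set~ v]; rewrite cardsC1 card_ord => h.
  apply: leq_ltn_trans (h _) _; last by rewrite ltn_predL (leq_ltn_trans _ (ltn_ord v)).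
  apply/forallP => w; rewrite !inE negbK; apply/implyP => /eqP ->.
  by apply/existsP; exists u; rewrite !inE uv /adjv setUC -euv.
- move=> B0 _; apply; apply/andP; split.
    by apply/subsetP => f; rewrite !inE => /orP[]/andP[].
  case: (domination_number_attained (E :\: B)) => D dD <-.
  have isol w : (w == u) || (w == v) -> w \in D.
    move=> wuv; apply/negbNE/negP => wD.
    case/existsP: (implyP (forallP dD w) wD) => z /andP[_].
    rewrite /adjv !inE; case: (_ \in E); rewrite ?andbF //=.
    by case/orP: wuv => /eqP ->; rewrite eqxx ?orbT.
  have uD : u \in D by rewrite isol // eqxx.
  have vD : v \in D by rewrite isol // eqxx orbT.
  have : dominating E (D :\ v).
    apply/forallP => w; rewrite !inE negb_and negbK; apply/implyP => /orP[/eqP ->|wD].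
      by apply/existsP; exists u; rewrite !inE uv uD /adjv setUC -euv.
    case/existsP: (implyP (forallP dD w) wD) => z /andP[zD wz].
    have zv : z != v.
      by apply: contraTneq wz => ->; rewrite /adjv !inE eqxx !orbT; case: (_ \in E); rewrite ?andbF ?andbT ?orbT.
    apply/existsP; exists z; rewrite !inE zv zD /=.
    by move: wz; rewrite /adjv inE => /andP[].
  by move=> /domination_number_le h; apply: leq_ltn_trans h _; rewrite (cardsD1 v D) vD.
Qed.

Lemma card_le_max_degree E : E \subset complete_graph n -> (#|E| <= n * max_degree E)%N.
Proof.
move=> EU; apply: (@leq_trans (\sum_(v : 'I_n) #|[set e in E | v \in e]|)).
  apply: leq_trans (_ : #|\bigcup_v [set e in E | v \in e]| <= _)%N.
    apply/subset_leq_card/subsetP => e eE; have := subsetP EU e eE.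
    rewrite mem_complete => /cards2P[a [b [ab eab]]]; apply/bigcupP; exists a => //.
    by rewrite inE eE eab !inE eqxx.
  elim/big_ind2 : _ => [|A x B y hA hB|//]; first by rewrite cards0.
  by apply: leq_trans (leq_card_setU _ _) _; apply: leq_add.
rewrite -[X in (_ <= X * _)%N]card_ord -sum_nat_const.
by apply: leq_sum => v _; apply: card_incident.
Qed.

Lemma card_edge_pairs B :
  (\sum_u \sum_v ([set u; v] \in B) <= 2 * #|B|)%N.
Proof.
rewrite pair_big /=.
have memE (q : 'I_n * 'I_n) :
    ([set q.1; q.2] \in B : nat) = (\sum_(e in B) ([set q.1; q.2] == e))%N.
  case: (boolP (_ \in B)) => qB.
    by rewrite (bigD1 _ qB) /= eqxx big1 // => e /andP[_ /negPf]; rewrite eq_sym => ->.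
  by rewrite big1 // => e eB; case: eqP => // qe; rewrite qe eB in qB.
rewrite (eq_bigr _ (fun q _ => memE q)) exchange_big /= mulnC -sum_nat_const.
apply: leq_sum => e _.
case: (pickP (fun q : 'I_n * 'I_n => [set q.1; q.2] == e)) => [[a b] /= /eqP <-|h]; last first.
  by rewrite big1 // => q _; rewrite h.
have -> : (\sum_(q : 'I_n * 'I_n) ([set q.1; q.2] == [set a; b]) =
    #|[set q : 'I_n * 'I_n | [set q.1; q.2] == [set a; b]]|)%N.
  by rewrite -sum1dep_card [RHS]big_mkcond; apply: eq_bigr => q _; case: (_ == _).
apply: leq_trans (_ : #|[set (a, b); (b, a)]| <= 2)%N; last first.
  by rewrite cards2; case: (_ != _).
apply/subset_leq_card/subsetP => -[u v]; rewrite inE /= => /eqP uvab.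
have ab z : (z \in [set u; v]) = (z \in [set a; b]).
  by rewrite uvab.
move: (ab u) (ab v) (ab a) (ab b); rewrite !inE !xpair_eqE !eqxx /= !orbT.
rewrite (eq_sym a u) (eq_sym b v) (eq_sym a v) (eq_sym b u).
by case: (u == a) => /=; case: (v == b) => //=; case: (u == b); case: (v == a).
Qed.

End Deterministic.

Section Robust.
Variables (n k : nat) (R : realFieldType).
Implicit Types (E B : edge_set n) (D : {set 'I_n}) (u v : 'I_n).

Lemma sum_dom_count E :
  \sum_u dom_count k R u E =
  k%:R * \sum_(D : {set 'I_n} | #|D| == k) (dominating E D)%:R.
Proof.
rewrite /dom_count (exchange_big_dep (fun D : {set 'I_n} => #|D| == k)) /=; last first.
  by move=> u D _ /andP[].
rewrite mulr_sumr; apply: eq_bigr => D /eqP kD.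
rewrite (eq_bigl (mem D)) => [|u]; last by rewrite kD eqxx.
by rewrite sumr_const kD mulr_natl.
Qed.

(* If deleting [B] leaves [v] undominated by [D], all edges from [v] to [D] are in
   [B]. When there are at least [L] of them each one pays [1 / L]; otherwise a
   single one pays [x ^+ #|N(v) :&: D| / x ^+ L >= 1]. Sets [D] meeting the
   arbitrary set of bad vertices are paid for separately. *)
Lemma destroyed_bound E B D (bad : pred 'I_n) (L : nat) (x : R) :
  (0 < L)%N -> 0 < x <= 1 -> ~~ dominating (E :\: B) D ->
  (dominating E D)%:R <=
    \sum_(u | bad u) (u \in D)%:R * (dominating E D)%:R +
    \sum_u \sum_v ([set u; v] \in B)%:R *
     ((~~ bad u)%:R * ((u \in D)%:R * (dominating E D)%:R) / L%:R +
      ((u \in D) && (v \notin D))%:R *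
        ((dominating_but E D v)%:R * x ^+ #|E :&: star D v|) / x ^+ L) :> R.
Proof.
move=> L0 /andP[x0 x1] nd; set T1 := (X in X + _); set T2 := (X in _ + X).
have xn0 m : 0 <= x ^+ m by rewrite exprn_ge0 // ltW.
pose G u v : R := ([set u; v] \in B)%:R *
     ((~~ bad u)%:R * ((u \in D)%:R * (dominating E D)%:R) / L%:R +
      ((u \in D) && (v \notin D))%:R *
        ((dominating_but E D v)%:R * x ^+ #|E :&: star D v|) / x ^+ L).
have G0 u v : 0 <= G u v.
  by rewrite mulr_ge0 // addr_ge0 // !mulr_ge0 // invr_ge0.
have T10 : 0 <= T1 by apply: sumr_ge0 => u _; rewrite mulr_ge0.
have T20 : 0 <= T2 by apply: sumr_ge0 => u _; apply: sumr_ge0 => v _; apply: G0.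
case: (boolP (dominating E D)) => [dD|_]; last by rewrite addr_ge0.
case: (pickP (fun u => bad u && (u \in D))) => [u /andP[bu uD]|good].
  have : 1 <= T1; last by rewrite mulr1n; lra.
  rewrite /T1 (bigD1 u bu) /= uD dD mulr1 lerDl.
  by apply: sumr_ge0 => w _; rewrite mulr_ge0.
have goodD u : u \in D -> ~~ bad u.
  by move=> uD; have := good u; rewrite uD andbT => ->.
suff : 1 <= T2 by rewrite mulr1n; lra.
move: nd; rewrite dominatingE negb_forall => /existsP[v].
rewrite negb_imply inE => /andP[vD]; rewrite /dominated negbK => /eqP dv.
have sB u : [set u; v] \in E :&: star D v -> (u \in D) && ([set u; v] \in B).
  move=> uES; move: (uES); rewrite mem_star // => /andP[uE ->] /=.
  apply/negbNE/negP => uB; move/setP/(_ [set u; v]): dv.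
  by rewrite mem_star // !inE uB uE /=; move: uES; rewrite mem_star // uE /= => ->.
have le_T2 (r : seq 'I_n) : uniq r -> \sum_(u <- r) G u v <= T2.
  move=> ur; apply: (@le_trans _ _ (\sum_u G u v)).
    rewrite [leRHS](bigID (mem r)) /= big_uniq //= lerDl.
    by apply: sumr_ge0.
  apply: ler_sum => u _; rewrite (bigD1 v) //= -/(G u v) lerDl.
  by apply: sumr_ge0 => w _; apply: G0.
have imS : E :&: star D v = [set [set u; v] | u in [set u in D | [set u; v] \in E]].
  apply/setP => e; apply/idP/imsetP => [eES|[u]].
    move: (eES); rewrite inE => /andP[eE /imsetP[u uD eu]].
    by exists u => //; rewrite inE uD -eu.
  by rewrite inE => /andP[uD uE] ->; rewrite mem_star // uD uE.
pose N := [set u in D | [set u; v] \in E].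
have cN : #|E :&: star D v| = #|N|.
  rewrite imS card_in_imset // => u w; rewrite !inE => /andP[uD _] /andP[wD _].
  by apply: star_inj; rewrite inE; [apply: contraNneq vD => <-|apply: contraNneq vD => <-].
have NB u : u \in N -> (u \in D) && ([set u; v] \in B).
  by rewrite inE => /andP[uD uE]; apply: sB; rewrite mem_star // uD uE.
case: (leqP L #|N|) => [LN|NL].
  apply: le_trans (le_T2 (enum N) (enum_uniq _)); rewrite big_enum /=.
  apply: (@le_trans _ _ (\sum_(u in N) L%:R^-1)).
    rewrite sumr_const -[leRHS]mulr_natl ler_pdivlMr ?ltr0n // mul1r ler_nat //.
  apply: ler_sum => u /NB/andP[uD uB]; rewrite /G uB uD goodD // dD !mul1r.
  by rewrite lerDl !mulr_ge0 // invr_ge0.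
have /set0Pn[e] : E :&: star D v != set0.
  by move: dD; rewrite dominatingE => /forallP/(_ v)/implyP; rewrite inE; apply.
move=> eES; have : e \in [set [set u; v] | u in N] by rewrite -imS.
case/imsetP => u uN _; apply: le_trans (le_T2 [:: u] _) => //.
rewrite big_seq1; have /andP[uD uB] := NB _ uN.
rewrite /G uB uD goodD // vD dD dominating_butW // !mul1r cN.
apply: (@le_trans _ _ (x ^+ #|N| / x ^+ L)); last by rewrite lerDr invr_ge0.
by rewrite ler_pdivlMr ?exprn_gt0 // mul1r ler_wiXn2l ?(ltW x0) // ltnW.
Qed.

(* Call [u] bad when it lies in more than twice the expected number [mu] of
   dominating [k]-sets. Under the two moment hypotheses the bad vertices, the
   edges of [B] with many companions and those with few companions destroy at
   most [n * mu / (8 * k)] sets each, out of at least [3 * n * mu / (4 * k)]. *)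
Lemma robustly_dominated_of_moments E (t L : nat) (x mu : R) :
  (0 < n)%N -> (0 < k)%N -> (0 < t)%N -> (0 < L)%N -> 0 < x <= 1 -> 0 < mu ->
  (32 * k * t <= n * L)%N ->
  \sum_u (dom_count k R u E - mu) ^+ 2 <= mu ^+ 2 * n%:R / (16 * k%:R) ->
  128 * t%:R * k%:R ^+ 2 * \sum_u \sum_v weak_count k x u v E ^+ 2
    <= x ^+ (2 * L) * (n%:R * mu) ^+ 2 ->
  robustly_dominated k t E.
Proof.
move=> n0 k0 t0 L0 x01 mu0 tL hX hY; have /andP[x0 x1] := x01.
apply/forallP => B; apply/implyP => Bt; apply/negbNE/negP => nB.
have nd D : #|D| == k -> ~~ dominating (E :\: B) D.
  move=> kD; apply: contra nB => dD; apply/existsP; exists D; by rewrite kD.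
pose S := \sum_(D : {set 'I_n} | #|D| == k) (dominating E D)%:R : R.
pose bad u := 2 * mu < dom_count k R u E.
pose V := \sum_u (dom_count k R u E - mu) ^+ 2.
pose Y := \sum_u \sum_v weak_count k x u v E ^+ 2.
pose b u v : R := ([set u; v] \in B)%:R.
have kR0 : 0 < k%:R :> R by rewrite ltr0n.
have nR0 : 0 < n%:R :> R by rewrite ltr0n.
have tR0 : 0 < t%:R :> R by rewrite ltr0n.
have LR0 : 0 < L%:R :> R by rewrite ltr0n.
have z0 : 0 < x ^+ L by rewrite exprn_gt0.
have kn0 := lt0r_neq0 kR0; have nn0 := lt0r_neq0 nR0.
have tn0 := lt0r_neq0 tR0; have mun0 := lt0r_neq0 mu0.
have sum_b : \sum_u \sum_v b u v <= 2 * t%:R.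
  have -> : \sum_u \sum_v b u v = (\sum_u \sum_v ([set u; v] \in B))%:R.
    by rewrite natr_sum; apply: eq_bigr => u _; rewrite natr_sum.
  by rewrite -natrM ler_nat (leq_trans (card_edge_pairs B)) // leq_mul2l Bt.
have S_le : S <= \sum_(u | bad u) dom_count k R u E +
    \sum_u \sum_v b u v * ((~~ bad u)%:R * dom_count k R u E / L%:R +
      weak_count k x u v E / x ^+ L).
  apply: le_trans (_ : \sum_(D : {set 'I_n} | #|D| == k) _ <= _).
    by apply: ler_sum => D kD; apply: (destroyed_bound bad L0 x01 (nd D kD)).
  have dcE u : \sum_(D : {set 'I_n} | #|D| == k) (u \in D)%:R * (dominating E D)%:R
     = dom_count k R u E.
    rewrite /dom_count [RHS]big_mkcondr; apply: eq_bigr => D _.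
    by case: (u \in D); rewrite ?mul1r ?mul0r.
  have wcE u v : \sum_(D : {set 'I_n} | #|D| == k) ((u \in D) && (v \notin D))%:R *
        ((dominating_but E D v)%:R * x ^+ #|E :&: star D v|) = weak_count k x u v E.
    rewrite /weak_count [RHS]big_mkcondr; apply: eq_bigr => D _.
    by case: (_ && _); rewrite ?mul1r ?mul0r.
  rewrite big_split /=; apply: lerD.
    by rewrite exchange_big /=; apply: ler_sum => u _; rewrite dcE.
  rewrite exchange_big /=; apply: ler_sum => u _.
  rewrite exchange_big /=; apply: ler_sum => v _.
  rewrite -mulr_sumr big_split /= -!mulr_suml wcE.
  by rewrite -mulr_sumr dcE.
have bad_le : \sum_(u | bad u) dom_count k R u E <= mu * n%:R / (8 * k%:R).
  apply: (@le_trans _ _ (2 / mu * V)); last first.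
    rewrite -(@ler_pM2l _ (mu / 2)) ?divr_gt0 //.
    have -> : mu / 2 * (2 / mu * V) = V by field; lra.
    apply: le_trans hX _; rewrite le_eqVlt; apply/orP; left; apply/eqP; field.
    by rewrite kn0.
  rewrite /V mulr_sumr [leRHS](bigID bad) /= -[leLHS]addr0; apply: lerD; last first.
    by apply: sumr_ge0 => u _; rewrite mulr_ge0 ?sqr_ge0 // divr_ge0 // ltW.
  apply: ler_sum => u; rewrite /bad; move: (dom_count _ _ _ _) => X Xmu.
  rewrite -mulrA [mu^-1 * _]mulrC mulrA ler_pdivlMr // expr2; nra.
have light_le : \sum_u \sum_v b u v * ((~~ bad u)%:R * dom_count k R u E / L%:R)
   <= 4 * t%:R * mu / L%:R.
  apply: (@le_trans _ _ (\sum_u \sum_v b u v * (2 * mu / L%:R))).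
    apply: ler_sum => u _; apply: ler_sum => v _; apply: ler_wpM2l => //.
    apply: ler_wpM2r; first by rewrite invr_ge0.
    rewrite /bad -leNgt; case: (boolP (dom_count k R u E <= 2 * mu)) => h; first by rewrite /= mul1r.
    by rewrite /= mul0r mulr_ge0 // ltW.
  under eq_bigr => u _ do rewrite -mulr_suml.
  rewrite -mulr_suml.
  have -> : 4 * t%:R * mu / L%:R = 2 * t%:R * (2 * mu / L%:R) by field; lra.
  by apply: ler_wpM2r => //; rewrite divr_ge0 // mulr_ge0 // ltW.
have weak_le : \sum_u \sum_v b u v * (weak_count k x u v E / x ^+ L)
   <= n%:R * mu / (8 * k%:R).
  pose s := n%:R * mu / (16 * k%:R * t%:R).
  have s0 : 0 < s by rewrite divr_gt0 ?mulr_gt0.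
  apply: (@le_trans _ _ (\sum_u \sum_v (b u v * (s / 2) +
      weak_count k x u v E ^+ 2 / (2 * s * (x ^+ L) ^+ 2)))).
    apply: ler_sum => u _; apply: ler_sum => v _.
    move: (weak_count _ _ _ _ _) (x ^+ L) z0 => w z z0'.
    have h : w / z <= s / 2 + w ^+ 2 / (2 * s * z ^+ 2).
      have -> : w ^+ 2 / (2 * s * z ^+ 2) = (w / z) ^+ 2 / (2 * s) by field; lra.
      rewrite -subr_ge0.
      have -> : s / 2 + (w / z) ^+ 2 / (2 * s) - w / z = (s - w / z) ^+ 2 / (2 * s).
        by field; lra.
      by rewrite divr_ge0 ?sqr_ge0 // mulr_ge0 // ltW.
    rewrite /b; case: (_ \in B); first by rewrite !mul1r.
    rewrite !mul0r add0r divr_ge0 ?sqr_ge0 //.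
    by rewrite !mulr_ge0 ?sqr_ge0 // ltW.
  under eq_bigr => u _ do rewrite big_split /= -!mulr_suml.
  rewrite big_split /= -!mulr_suml -/Y.
  have h1 : (\sum_u \sum_v b u v) * (s / 2) <= n%:R * mu / (16 * k%:R).
    have -> : n%:R * mu / (16 * k%:R) = 2 * t%:R * (s / 2).
      by rewrite /s; field; rewrite ?kn0 ?tn0 ?nn0 ?mun0.
    by apply: ler_wpM2r => //; rewrite divr_ge0 // ltW.
  have h2 : Y / (2 * s * (x ^+ L) ^+ 2) <= n%:R * mu / (16 * k%:R).
    rewrite ler_pdivrMr; last by apply: mulr_gt0; [apply: mulr_gt0|apply: exprn_gt0].
    move: hY; rewrite -/Y mulnC exprM /s => hY.
    rewrite -(@ler_pM2l _ (128 * t%:R * k%:R ^+ 2)); last by apply: mulr_gt0; [apply: mulr_gt0|apply: exprn_gt0].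
    apply: le_trans hY _; rewrite le_eqVlt; apply/orP; left; apply/eqP.
    by move: (x ^+ L) => z; field; rewrite ?kn0 ?tn0 ?nn0 ?mun0.
  have -> : n%:R * mu / (8 * k%:R) = n%:R * mu / (16 * k%:R) + n%:R * mu / (16 * k%:R).
    by field; rewrite kn0.
  exact: lerD.
have light_le' : 4 * t%:R * mu / L%:R <= n%:R * mu / (8 * k%:R).
  rewrite ler_pdivrMr // [leRHS]mulrAC ler_pdivlMr ?mulr_gt0 //.
  have : 32 * k%:R * t%:R <= n%:R * L%:R :> R by rewrite -!natrM ler_nat.
  move=> h; have := ler_wpM2r (ltW mu0) h; lra.
have S_small : S <= 3 * (n%:R * mu / (8 * k%:R)).
  apply: le_trans S_le _.
  have -> : \sum_u \sum_v b u v * ((~~ bad u)%:R * dom_count k R u E / L%:R +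
      weak_count k x u v E / x ^+ L) =
    \sum_u \sum_v b u v * ((~~ bad u)%:R * dom_count k R u E / L%:R) +
    \sum_u \sum_v b u v * (weak_count k x u v E / x ^+ L).
    rewrite -big_split; apply: eq_bigr => u _; rewrite -big_split.
    by apply: eq_bigr => v _; rewrite mulrDr.
  move: bad_le light_le light_le' weak_le; rewrite [mu * n%:R]mulrC; lra.
have S_big : 3 / 4 * (n%:R * mu) <= k%:R * S.
  rewrite /S -sum_dom_count.
  apply: (@le_trans _ _ (\sum_u (7 / 8 * mu - 2 / mu * (dom_count k R u E - mu) ^+ 2))).
    rewrite big_split /= sumr_const card_ord sumrN -mulr_sumr -/V -[X in _ <= X - _]mulr_natl.
    have : 2 / mu * V <= n%:R * mu / 8.
      have -> : n%:R * mu / 8 = 2 / mu * (mu ^+ 2 * n%:R / 16) by field; lra.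
      apply: ler_wpM2l; first by rewrite divr_ge0 // ltW.
      apply: le_trans hX _; apply: ler_wpM2l; first by rewrite mulr_ge0 ?sqr_ge0.
      rewrite lef_pV2 ?posrE ?mulr_gt0 // ler_peMr // ?ler1n ?k0 //.
    lra.
  apply: ler_sum => u _; move: (dom_count _ _ _ _) => X.
  rewrite -subr_ge0.
  have -> : X - (7 / 8 * mu - 2 / mu * (X - mu) ^+ 2) =
    2 / mu * ((X - mu + mu / 4) ^+ 2) by field; lra.
  by rewrite mulr_ge0 ?sqr_ge0 // divr_ge0 // ltW.
have : k%:R * S <= 3 / 8 * (n%:R * mu).
  have -> : 3 / 8 * (n%:R * mu) = k%:R * (3 * (n%:R * mu / (8 * k%:R))).
    by field; rewrite kn0.
  by apply: ler_wpM2l => //; apply: ltW.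
have : 0 < n%:R * mu by rewrite mulr_gt0.
lra.
Qed.

End Robust.

(** * From G(n,p) to G(n,m) *)

Section Chebyshev.
Variables (R : realFieldType) (T : finType) (p : R).
Implicit Types (U E : {set T}).

Let cardB U E : R := #|E|%:R - #|U|%:R * p.

Lemma cardB_setU e U E E' : e \notin U -> E' \subset U -> E \subset [set e] ->
  cardB (e |: U) (E :|: E') = (#|E|%:R - p) + cardB U E'.
Proof.
move=> eU E'U; rewrite subset1 /cardB cardsU1 eU natrD => /orP[] /eqP ->.
  rewrite cardsU1 (contra (subsetP E'U e) eU) cards1 natrD /=; ring.
by rewrite set0U cards0 /=; ring.
Qed.

Lemma Ex_cardB U : Ex p U (cardB U) = 0 /\
  Ex p U (fun E => cardB U E ^+ 2) = #|U|%:R * (p * (1 - p)).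
Proof.
move: {2}#|U| (erefl #|U|) => d; elim: d U => [|d IH] U cU.
  by move/cards0_eq: (cU) ->; rewrite !Ex_set0 /cardB !cards0 !mul0r subrr expr0n.
have /card_gt0P[e eU] : (0 < #|U|)%N by rewrite cU.
have cU' : #|U :\ e| = d by apply: succn_inj; rewrite -cU (cardsD1 e U) eU.
have eU' : e \notin U :\ e by rewrite !inE eqxx.
have [IH1 IH2] := IH _ cU'.
rewrite -(setD1K eU) !Ex_setU ?disjoints1 // !Ex_set1.
have h E (g : R -> R) : E \subset [set e] ->
    Ex p (U :\ e) (fun E' => g (cardB (e |: U :\ e) (E :|: E'))) =
    Ex p (U :\ e) (fun E' => g (#|E|%:R - p + cardB (U :\ e) E')).
  by move=> Ee; apply: eq_Ex => E' E'U; rewrite cardB_setU.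
have h1 c : Ex p (U :\ e) (fun E' => c + cardB (U :\ e) E') = c.
  by rewrite ExD Ex_cst IH1 addr0.
have h2 c : Ex p (U :\ e) (fun E' => (c + cardB (U :\ e) E') ^+ 2) =
    c ^+ 2 + #|U :\ e|%:R * (p * (1 - p)).
  rewrite (@eq_Ex _ _ _ _ _ (fun E' => c ^+ 2 + ((2 * c) * cardB (U :\ e) E' +
    cardB (U :\ e) E' ^+ 2))); last by move=> E' _; move: (cardB _ _) => z; ring.
  by rewrite !ExD ExZ Ex_cst IH1 IH2 mulr0 add0r.
rewrite !(h _ id) ?(h _ (fun y => y ^+ 2)) ?sub0set ?subxx //= !h1 !h2.
have -> : #|[set e]|%:R = 1 :> R by rewrite cards1.
have -> : #|@set0 T|%:R = 0 :> R by rewrite cards0.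
have -> : #|e |: U :\ e|%:R = 1 + #|U :\ e|%:R :> R by rewrite cardsU1 eU' natrD.
move: (#|U :\ e|%:R : R) => c; split; ring.
Qed.

Lemma Chebyshev_card U (s : R) (P : pred {set T}) : 0 <= p <= 1 -> 0 < s ->
  (forall E, E \subset U -> P E -> s <= `|#|E|%:R - #|U|%:R * p|) ->
  Pr p U P <= #|U|%:R / s ^+ 2.
Proof.
move=> p01 s0 hP; have [_ VE] := Ex_cardB U.
apply: (@le_trans _ _ (Ex p U (fun E => cardB U E ^+ 2) / s ^+ 2)).
  apply: markov_Ex => //; first exact: exprn_gt0.
    by move=> E _; apply: sqr_ge0.
  move=> E EU PE; rewrite -[leRHS]real_normK ?num_real // lerXn2r ?nnegrE ?(ltW s0) //.
  exact: hP.
rewrite VE ler_wpM2r ?invr_ge0 ?sqr_ge0 // ler_piMr //.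
by case/andP: p01 => p0 p1; nra.
Qed.

End Chebyshev.

Section Transfer.
Variables (R : realType) (n : nat).
Let U := complete_graph n.
Let N := 'C(n, 2).
Implicit Types (E : edge_set n) (P : pred (edge_set n)).

Definition increasing P := forall E E', E \subset E' -> E' \subset U -> P E -> P E'.

Lemma card_complete : #|U| = N.
Proof. by rewrite /U /complete_graph card_draws card_ord. Qed.

Lemma card_graphs_with m : #|graphs_with n m| = 'C(N, m).
Proof. by rewrite /graphs_with cards_draws card_complete. Qed.

(* Double counting of the pairs of graphs differing by one edge. *)
Lemma card_increasing P j : increasing P ->
  ((N - j) * #|[set E in graphs_with n j | P E]| <=
   j.+1 * #|[set E in graphs_with n j.+1 | P E]|)%N.
Proof.
move=> incP; pose A := [set E in graphs_with n j | P E].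
pose B := [set E in graphs_with n j.+1 | P E].
pose X := [set q : edge_set n * {set 'I_n} | (q.1 \in A) && (q.2 \in U :\: q.1)].
pose Y := [set q : edge_set n * {set 'I_n} | (q.1 \in B) && (q.2 \in q.1)].
have card_pairs (C : {set edge_set n}) (F : edge_set n -> {set {set 'I_n}}) d :
    (forall E, E \in C -> #|F E| = d) ->
    #|[set q : edge_set n * {set 'I_n} | (q.1 \in C) && (q.2 \in F q.1)]| = (d * #|C|)%N.
  move=> cF; rewrite -sum1dep_card -(pair_big_dep (mem C) (fun E e => e \in F E) (fun _ _ => 1%N)) /=.
  rewrite (eq_bigr (fun=> d)) => [|E EC]; last by rewrite sum1_card cF.
  by rewrite sum_nat_const mulnC.
have inA E : E \in A -> [/\ E \subset U, #|E| = j & P E].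
  by rewrite !inE => /andP[/andP[? /eqP ?] ?].
have cX : #|X| = ((N - j) * #|A|)%N.
  apply: (card_pairs _ (fun E => U :\: E)) => E /inA[EU cE _].
  by rewrite cardsD (setIidPr EU) cE card_complete.
have cY : #|Y| = (j.+1 * #|B|)%N.
  by apply: (card_pairs _ id) => E; rewrite !inE => /andP[/andP[_ /eqP]].
rewrite -cX -cY.
rewrite -(@card_in_imset _ _ (fun q : edge_set n * {set 'I_n} => (q.2 |: q.1, q.2)) X).
  apply/subset_leq_card/subsetP => -[E' e'] /imsetP[[E e]].
  rewrite inE /= => /andP[/inA[EU cE PE]]; rewrite in_setD => /andP[eE eU] [-> ->].
  have sU : e |: E \subset U by rewrite subUset sub1set eU.
  rewrite !inE sU cardsU1 eE cE eqxx /= eqxx /= andbT.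
  exact: (incP E _ (subsetUr _ _) sU PE).
move=> [E e] [E' e']; rewrite !inE /= => /andP[_ /andP[eE _]] /andP[_ /andP[eE' _]] [h eqe].
rewrite -eqe in eE' h *; congr pair.
by rewrite -(setU1K eE) h setU1K.
Qed.

Lemma prob_gnmS P j : (j < N)%N -> increasing P ->
  prob_gnm R j P <= prob_gnm R j.+1 P.
Proof.
move=> jN incP; rewrite /prob_gnm !card_graphs_with.
have b0 : 0 < ('C(N, j))%:R :> R by rewrite ltr0n bin_gt0 ltnW.
have b1 : 0 < ('C(N, j.+1))%:R :> R by rewrite ltr0n bin_gt0.
rewrite ler_pdivrMr // mulrAC ler_pdivlMr // -!natrM ler_nat.
have := card_increasing j incP; have := mul_bin_left N j.
move: #|_| #|_| => a' a hb ha.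
rewrite -(@leq_pmul2l (j.+1 * (N - j))); last by rewrite muln_gt0 subn_gt0.
have -> : (j.+1 * (N - j) * (a * 'C(N, j.+1)) = (j.+1 * 'C(N, j.+1)) * ((N - j) * a))%N.
  by ring.
have -> : (j.+1 * (N - j) * (a' * 'C(N, j)) = ((N - j) * 'C(N, j)) * (j.+1 * a'))%N.
  by ring.
by rewrite hb leq_mul2l ha orbT.
Qed.

Lemma prob_gnm_le P j m : (j <= m <= N)%N -> increasing P ->
  prob_gnm R j P <= prob_gnm R m P.
Proof.
move=> /andP[jm mN] incP; rewrite -(subnK jm) in mN *.
elim: (m - j)%N mN => [|d IH] mN //; rewrite addSn in mN *.
by apply: le_trans (IH (ltnW mN)) _; apply: prob_gnmS.
Qed.

Lemma prob_gnmC P m : (m <= N)%N -> prob_gnm R m (predC P) = 1 - prob_gnm R m P.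
Proof.
move=> mN; apply/eqP; rewrite eq_sym subr_eq /prob_gnm -mulrDl -natrD.
have -> : (#|[set E in graphs_with n m | predC P E]| +
   #|[set E in graphs_with n m | P E]| = #|graphs_with n m|)%N.
  rewrite -(cardsID [set E | P E] (graphs_with n m)) addnC.
  by congr (_ + _)%N; apply: eq_card => E; rewrite !inE // andbC.
by rewrite divff // card_graphs_with pnatr_eq0 -lt0n bin_gt0.
Qed.

Lemma prob_gnm_inter (P Q P' : pred (edge_set n)) m : (m <= N)%N ->
  (forall E, E \in graphs_with n m -> P E -> Q E -> P' E) ->
  prob_gnm R m P + prob_gnm R m Q - 1 <= prob_gnm R m P'.
Proof.
move=> mN PQ; rewrite lerBlDr /prob_gnm -mulrDl -natrD.
have G0 : 0 < #|graphs_with n m|%:R :> R by rewrite ltr0n card_graphs_with bin_gt0.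
rewrite ler_pdivrMr // mulrDl mul1r divfK ?lt0r_neq0 // -natrD ler_nat.
set A := [set E in _ | P E]; set B := [set E in _ | Q E].
rewrite -cardsUI addnC; apply: leq_add; apply/subset_leq_card/subsetP => E.
  rewrite !inE => /andP[/andP[/andP[EU cE] PE] /andP[_ QE]].
  by rewrite EU cE PQ // inE EU.
by rewrite !inE => /orP[] /andP[].
Qed.

Variable p : R.
Hypothesis p01 : 0 <= p <= 1.

Lemma Pr_card_le P (Q : pred nat) (c : R) : 0 <= c ->
  (forall j, (j <= N)%N -> Q j -> prob_gnm R j P <= c) ->
  Pr p U (fun E => P E && Q #|E|) <= c.
Proof.
move=> c0 hc; rewrite /Pr /Ex.
have cU E : E \subset U -> (#|E| < N.+1)%N.
  by move=> EU; rewrite ltnS -card_complete subset_leq_card.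
rewrite (partition_big (fun E => inord #|E| : 'I_N.+1) predT) //=.
rewrite -[leRHS]mulr1 -[X in _ <= _ * X](Ex_cst p U 1) /Ex mulr_sumr.
rewrite [leRHS](partition_big (fun E => inord #|E| : 'I_N.+1) predT) //=.
apply: ler_sum => j _.
have condE E : (E \subset U) && (inord #|E| == j) = (E \in graphs_with n j).
  rewrite inE; case: (boolP (E \subset U)) => //= EU.
  by rewrite -val_eqE /= inordK // cU.
have w0 : 0 <= p ^+ j * (1 - p) ^+ (N - j).
  by case/andP: p01 => p0 p1; rewrite mulr_ge0 // exprn_ge0 // subr_ge0.
have wE E : E \in graphs_with n j -> subset_weight p U E = p ^+ j * (1 - p) ^+ (N - j).
  rewrite inE /subset_weight => /andP[EU /eqP cE].
  by rewrite cardsD (setIidPr EU) card_complete cE.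
rewrite (eq_bigl _ _ condE) [leRHS](eq_bigl _ _ condE).
rewrite [leRHS](eq_bigr (fun=> c * (p ^+ j * (1 - p) ^+ (N - j)))); last first.
  by move=> E /wE ->; rewrite mulr1.
case: (boolP (Q j)) => Qj; last first.
  rewrite big1 => [|E Ej]; first by apply: sumr_ge0 => E _; rewrite mulr_ge0.
  by move: Ej; rewrite inE => /andP[_ /eqP ->]; rewrite (negPf Qj) andbF mulr0.
rewrite [leLHS](eq_bigr (fun E => p ^+ j * (1 - p) ^+ (N - j) * (P E)%:R)); last first.
  move=> E Ej; rewrite wE //; move: Ej; rewrite inE => /andP[_ /eqP ->].
  by rewrite Qj andbT.
rewrite -mulr_sumr sumr_const.
have -> : \sum_(E in graphs_with n j) (P E)%:R = #|[set E in graphs_with n j | P E]|%:R :> R.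
  rewrite -natr_sum -sum1dep_card [in RHS]big_mkcondr /=; congr (_%:R).
rewrite -[leRHS]mulr_natr [leRHS]mulrAC mulrC; apply: ler_wpM2r => //.
have := hc j; rewrite /prob_gnm ler_pdivrMr; first by apply => //; rewrite -ltnS.
by rewrite ltr0n card_graphs_with bin_gt0 -ltnS.
Qed.

Lemma prob_gnm_ge0 m P : 0 <= prob_gnm R m P.
Proof. by rewrite divr_ge0. Qed.

Lemma increasing_transfer P m (s : R) : (m <= N)%N -> 0 < s -> increasing P ->
  N%:R * p + s <= m%:R -> Pr p U P - N%:R / s ^+ 2 <= prob_gnm R m P.
Proof.
move=> mN s0 incP mp; rewrite lerBlDr.
apply: (@le_trans _ _ (Pr p U (predU (fun E => P E && (#|E| <= m)%N) (fun E => m < #|E|)%N))).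
  by apply: le_Pr => // E _ PE; rewrite /= PE; case: leqP.
apply: le_trans (Pr_predU p01 _ _ _) _; apply: lerD.
  apply: (@Pr_card_le P (fun j => j <= m)%N) => [|j jN jm]; first exact: prob_gnm_ge0.
  by apply: prob_gnm_le; rewrite // jm.
rewrite -card_complete; apply: Chebyshev_card => // E EU mE.
rewrite card_complete ler_normr; apply/orP; left.
have : m%:R <= #|E|%:R :> R by rewrite ler_nat ltnW.
lra.
Qed.

Lemma decreasing_transfer P m (s : R) : (m <= N)%N -> 0 < s -> increasing (predC P) ->
  m%:R <= N%:R * p - s -> Pr p U P - N%:R / s ^+ 2 <= prob_gnm R m P.
Proof.
move=> mN s0 decP mp; rewrite lerBlDr.
apply: (@le_trans _ _ (Pr p U (predU (fun E => P E && (m <= #|E|)%N) (fun E => #|E| < m)%N))).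
  by apply: le_Pr => // E _ PE; rewrite /= PE; case: leqP.
apply: le_trans (Pr_predU p01 _ _ _) _; apply: lerD.
  apply: (@Pr_card_le P (fun j => m <= j)%N) => [|j jN jm]; first exact: prob_gnm_ge0.
  rewrite -(lerN2) -(lerD2l 1) -!prob_gnmC //.
  by apply: prob_gnm_le; rewrite // jm.
rewrite -card_complete; apply: Chebyshev_card => // E EU mE.
rewrite card_complete ler_normr; apply/orP; right.
have : #|E|%:R <= m%:R :> R by rewrite ler_nat ltnW.
lra.
Qed.

End Transfer.

Section FirstMoments.
Variables (n : nat) (R : realFieldType) (p : R).
Hypothesis p01 : 0 <= p <= 1.
Let U := complete_graph n.
Implicit Types (E : edge_set n).

Lemma increasing_has_dominating k : increasing (@has_dominating n k).
Proof.
move=> E E' EE' _ /existsP[D /andP[kD dD]]; apply/existsP; exists D.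
by rewrite kD (dominatingS EE' (subxx D)).
Qed.

Lemma increasing_robustly_dominated k t : increasing (@robustly_dominated n k t).
Proof.
move=> E E' EE' E'U /forallP rob; apply/forallP => B; apply/implyP => Bt.
apply: increasing_has_dominating (implyP (rob B) Bt); first exact: setSD.
by apply: subset_trans E'U; apply: subsetDl.
Qed.

Lemma increasing_max_degree d : increasing (fun E => (d < max_degree E)%N).
Proof.
move=> E E' EE' _ /leq_trans; apply; apply/bigmax_leqP => v _.
apply: leq_trans (leq_bigmax v); apply/subset_leq_card/subsetP => u.
by rewrite !inE; apply: (subsetP EE').
Qed.

Lemma Pr_has_dominating k :
  Pr p U (has_dominating k) <= 'C(n, k)%:R * (1 - (1 - p) ^+ k) ^+ (n - k).
Proof.
apply: (@le_trans _ _ (Ex p U (fun E =>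
    \sum_(D : {set 'I_n} | #|D| == k) (dominating E D)%:R))).
  apply: le_Ex => // E _; case: (boolP (has_dominating k E)) => [/existsP[D /andP[kD dD]]|_].
    by rewrite (bigD1 D) //= dD lerDl sumr_ge0.
  exact: sumr_ge0.
rewrite Ex_sum (eq_bigr (fun=> (1 - (1 - p) ^+ k) ^+ (n - k))) => [|D /eqP kD].
  have <- : #|[set D : {set 'I_n} | #|D| == k]| = 'C(n, k) by rewrite card_draws card_ord.
  by rewrite sumr_const -[leLHS]mulr_natl cardsE.
by rewrite Ex_dominating kD.
Qed.

Lemma Pr_max_degree d : (0 < d)%N ->
  Pr p U (fun E => (d <= max_degree E)%N) <= n%:R * (1 + p) ^+ n / 2 ^+ d.
Proof.
move=> d0; have [p0 p1] := andP p01.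
apply: le_trans (_ : Ex p U (fun E => \sum_v 2 ^+ #|E :&: star [set~ v] v|) / 2 ^+ d <= _).
  apply: markov_Ex; rewrite ?exprn_gt0 //.
    by move=> E _; apply: sumr_ge0 => v _; rewrite exprn_ge0.
  move=> E EU dE.
  have [v vE] : exists v, (d <= vdegree E v)%N.
    apply/existsP; apply: contraLR dE; rewrite negb_exists => /forallP h.
    rewrite -ltnNge -(prednK d0) ltnS; apply/bigmax_leqP => v _.
    by rewrite -ltnS (prednK d0) ltnNge h.
  rewrite (bigD1 v) //= -[leLHS]addr0; apply: lerD.
    rewrite ler_weXn2l ?ler1n // (leq_trans vE) // /vdegree.
    have adj_neq u : adjv E v u -> u != v.
      apply: contraTneq => ->; apply/negP => /(subsetP EU).
      by rewrite mem_complete setUid cards1.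
    rewrite -(@card_in_imset _ _ (fun u => [set u; v])); last first.
      by move=> u w; rewrite !inE => /adj_neq uv /adj_neq wv; apply: star_inj.
    apply/subset_leq_card/subsetP => e /imsetP[u]; rewrite inE => vu ->.
    rewrite mem_star ?inE ?eqxx // adj_neq // andbT.
    by move: vu; rewrite /adjv setUC.
  by apply: sumr_ge0 => w _; rewrite exprn_ge0.
rewrite ler_wpM2r ?invr_ge0 ?exprn_ge0 // Ex_sum.
apply: (@le_trans _ _ (\sum_(v : 'I_n) (1 + p) ^+ n)).
  apply: ler_sum => v _; rewrite Ex_pow ?star_complete ?card_star ?inE ?eqxx //.
  rewrite (_ : 1 - p + p * 2 = 1 + p); last by ring.
  by rewrite ler_weXn2l ?lerDl // cardsC1 card_ord leq_pred.
by rewrite sumr_const card_ord mulr_natl.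
Qed.

End FirstMoments.

(** * Pairs of k-sets with a given overlap *)

Section Overlap.
Variables (n k : nat) (R : realType).
Implicit Types (D I A : {set 'I_n}).

Lemma sum_subset_pow (T : finType) (A : {set T}) (a : R) :
  \sum_(I : {set T} | I \subset A) a ^+ #|I| = (1 + a) ^+ #|A|.
Proof.
have h := @Ex_pow_card R T (2^-1) A a.
have h2 : (2^-1 : R) != 0 by rewrite invr_eq0 pnatr_eq0.
apply: (@mulfI _ (2^-1 ^+ #|A|)); first by rewrite expf_neq0.
rewrite -exprMn (_ : 2^-1 * (1 + a) = 1 - 2^-1 + 2^-1 * a); last by field.
rewrite -h /Ex mulr_sumr; apply: eq_bigr => I IA.
rewrite /subset_weight (_ : 1 - 2^-1 = 2^-1 :> R); last by field.
by rewrite -exprD cardsD (setIidPr IA) subnKC // subset_leq_card.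
Qed.

Lemma bin_ratio_le m l j : (j <= l <= m)%N ->
  'C(m - j, l - j)%:R <= 'C(m, l)%:R * (l%:R / m%:R) ^+ j :> R.
Proof.
elim: j m l => [|j IH] m l; first by rewrite !subn0 expr0 mulr1.
case: l => [|l]; first by rewrite ltn0.
case: m => [|m]; first by rewrite !ltnS ltn0 andbF.
rewrite !ltnS !subSS => jlm; have /andP[jl lm] := jlm.
apply: le_trans (IH _ _ jlm) _; rewrite exprS mulrA; apply: ler_pM; rewrite ?exprn_ge0 ?divr_ge0 //.
- rewrite mulrA ler_pdivlMr ?ltr0n // -!natrM ler_nat.
  by have := mul_bin_diag m.+1 l; rewrite /= mulnC => ->; rewrite mulnC.
- case: (posnP m) => [m0|m0].
    have [-> ->] : l = 0%N /\ j = 0%N by lia.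
    by rewrite !expr0.
  rewrite lerXn2r ?nnegrE ?divr_ge0 // ler_pdivrMr ?ltr0n // mulrAC.
  by rewrite ler_pdivlMr ?ltr0n // -!natrM ler_nat; lia.
Qed.

Lemma sum_pow_overlap D (z : R) : (0 < n)%N -> #|D| = k -> (k <= n)%N -> 1 <= z ->
  \sum_(D' : {set 'I_n} | #|D'| == k) z ^+ #|D :&: D'|
  <= 'C(n, k)%:R * expR (z * k%:R ^+ 2 / n%:R).
Proof.
move=> n0 cD kn z1.
have -> : \sum_(D' : {set 'I_n} | #|D'| == k) z ^+ #|D :&: D'| =
    \sum_(I : {set 'I_n} | I \subset D) (z - 1) ^+ #|I| * 'C(n - #|I|, k - #|I|)%:R.
  rewrite (eq_bigr (fun D' => \sum_(I : {set 'I_n} | (I \subset D) && (I \subset D'))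
     (z - 1) ^+ #|I|)) => [|D' _]; last first.
    rewrite -[z in LHS](subrKC 1) -sum_subset_pow; apply: eq_bigl => I.
    exact: subsetI.
  rewrite (exchange_big_dep (fun I => I \subset D)) /=; last by move=> D' I _ /andP[].
  apply: eq_bigr => I ID; rewrite -card_supersets; last by rewrite -cD subset_leq_card.
  by rewrite sumr_const mulr_natr; congr (_ *+ _); apply: eq_card => D'; rewrite !inE ID.
apply: (@le_trans _ _ (\sum_(I : {set 'I_n} | I \subset D)
    'C(n, k)%:R * ((z - 1) * (k%:R / n%:R)) ^+ #|I|)).
  apply: ler_sum => I ID; rewrite exprMn [leRHS]mulrCA; apply: ler_wpM2l; first by rewrite exprn_ge0 // subr_ge0.
  by apply: bin_ratio_le; rewrite kn andbT -cD subset_leq_card.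
rewrite -mulr_sumr sum_subset_pow; apply: ler_wpM2l => //.
have h0 : 0 <= (z - 1) * (k%:R / n%:R) by rewrite mulr_ge0 ?subr_ge0 // divr_ge0.
apply: (@le_trans _ _ (expR ((z - 1) * (k%:R / n%:R)) ^+ #|D|)).
  apply: lerXn2r; rewrite ?nnegrE ?addr_ge0 ?expR_ge0 ?expR_ge1Dx //.
rewrite -expRM_natl ler_expR cD.
have -> : z * k%:R ^+ 2 / n%:R = k%:R * (z * (k%:R / n%:R)) by rewrite expr2; ring.
by rewrite ler_wpM2l // ler_wpM2r ?divr_ge0 // gerBl.
Qed.

Lemma expR_sub1_le (y : R) : 0 <= y <= 2^-1 -> expR y - 1 <= 2 * y.
Proof.
move=> /andP[y0 y1]; have h : 0 < 1 - y by lra.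
have : expR y <= (1 - y)^-1.
  rewrite -[leLHS]invrK lef_pV2 ?posrE ?invr_gt0 ?expR_gt0 //.
  by rewrite -expRN expR_ge1Dx.
move=> /le_trans h1; rewrite lerBlDr; apply: h1.
rewrite -[leLHS]mul1r ler_pdivrMr //; nra.
Qed.

Lemma bin_le_exp m j : ('C(m, j) <= m ^ j)%N.
Proof.
elim: j m => [|j IH] m; first by rewrite bin0.
rewrite -(leq_pmul2l (ltn0Sn j)) -mul_bin_diag expnS.
apply: (@leq_trans (m * m ^ j)); last exact: leq_pmull.
rewrite leq_mul2l (leq_trans (IH _)) ?orbT //.
by case: j {IH} => // j; rewrite leq_exp2r ?leq_pred.
Qed.

(* Since [i * z ^+ i <= (2 * z) ^+ i - 1], this reduces to [sum_pow_overlap]. *)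
Lemma sum_mul_pow_overlap D (z : R) : #|D| = k -> (k <= n)%N -> 1 <= z ->
  4 * z * k%:R ^+ 2 <= n%:R -> (0 < n)%N ->
  \sum_(D' : {set 'I_n} | #|D'| == k) #|D :&: D'|%:R * z ^+ #|D :&: D'|
  <= 'C(n, k)%:R * (4 * z * k%:R ^+ 2 / n%:R).
Proof.
move=> cD kn z1 zk n0.
have z0 : 0 <= z by apply: le_trans z1.
apply: (@le_trans _ _ (\sum_(D' : {set 'I_n} | #|D'| == k) ((2 * z) ^+ #|D :&: D'| - 1))).
  apply: ler_sum => D' _; case: #|_| => [|i]; first by rewrite mul0r expr0 subrr.
  rewrite exprMn lerBrDr.
  have h : i.+1%:R + 1 <= 2 ^+ i.+1 :> R.
    by rewrite -natrX -[1]/(1%:R) -natrD ler_nat addn1; apply: ltn_expl.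
  have : 1 <= z ^+ i.+1 by rewrite exprn_ege1.
  move: (z ^+ _) => w w1; nra.
rewrite big_split /= sumr_const.
have -> : - 1 *+ #|[pred D' : {set 'I_n} | #|D'| == k]| = - 'C(n, k)%:R :> R.
  by rewrite mulNrn -[n in RHS]card_ord -card_draws cardsE.
have := @sum_pow_overlap D (2 * z) n0 cD kn; move/(_ _)/le_trans.
move=> h; rewrite lerBlDr; apply: h; first by lra.
rewrite -lerBlDr -{2}['C(n, k)%:R]mulr1 -mulrBr; apply: ler_wpM2l => //.
have -> : 4 * z * k%:R ^+ 2 / n%:R = 2 * (2 * z * k%:R ^+ 2 / n%:R) by ring.
apply: expR_sub1_le; rewrite divr_ge0 ?mulr_ge0 ?sqr_ge0 //=.
by rewrite ler_pdivrMr ?ltr0n //; lra.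
Qed.

Lemma card_far_sets D j : #|D| = k ->
  (#|[set D' : {set 'I_n} | (#|D'| == k) && ((k - #|D :&: D'|)%N == j)]| <= n ^ (2 * j))%N.
Proof.
move=> cD; pose J := [set A : {set 'I_n} | #|A| == j].
apply: (@leq_trans #|setX J J|).
  rewrite -(@card_in_imset _ _ (fun D' => (D :\: D', D' :\: D))).
    apply/subset_leq_card/subsetP => -[A B] /imsetP[D']; rewrite inE => /andP[/eqP cD' ij] [-> ->].
    by rewrite !inE /= !cardsD cD cD' [D' :&: D]setIC ij.
  move=> A B _ _ [hA hB]; apply/setP => x; move/setP/(_ x): hA; move/setP/(_ x): hB.
  by rewrite !inE; case: (x \in D); case: (x \in A); case: (x \in B).
rewrite cardsX card_draws card_ord mul2n -addnn expnD; apply: leq_mul;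
  exact: bin_le_exp.
Qed.

(* Overlaps up to [15 k / 16] are summed by the generating function of the overlap,
   the larger ones by the crude count of [card_far_sets]. *)
Lemma sum_overlap (T : nat -> R) (c z h : R) D : #|D| = k -> (0 < k <= n)%N ->
  1 <= z -> 0 <= c -> 0 <= h -> 4 * z * k%:R ^+ 2 <= n%:R ->
  (forall i, (16 * i <= 15 * k)%N -> T i <= c * z ^+ i) ->
  (forall j, (16 * j < k)%N -> n%:R ^+ (2 * j) * T (k - j)%N <= h) ->
  \sum_(D' : {set 'I_n} | #|D'| == k) #|D :&: D'|%:R * T #|D :&: D'|
  <= 'C(n, k)%:R * (c * (4 * z * k%:R ^+ 2 / n%:R)) + n%:R ^+ 2 * h.
Proof.
move=> cD /andP[k0 kn] z1 c0 h0 zk Tlow Thigh.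
have n0 : (0 < n)%N by apply: leq_trans kn.
have z0 : 0 <= z by apply: le_trans z1.
pose low D' := (16 * #|D :&: D'| <= 15 * k)%N.
have ik D' : (#|D :&: D'| <= k)%N by rewrite -cD subset_leq_card // subsetIl.
rewrite (bigID low) /=; apply: lerD.
  apply: (@le_trans _ _ (c * \sum_(D' : {set 'I_n} | #|D'| == k)
     #|D :&: D'|%:R * z ^+ #|D :&: D'|)); last first.
    by rewrite mulrCA; apply: ler_wpM2l => //; apply: sum_mul_pow_overlap.
  rewrite mulr_sumr [leRHS](bigID low) /= -[leLHS]addr0; apply: lerD; last first.
    by apply: sumr_ge0 => D' _; rewrite !mulr_ge0 // exprn_ge0.
  by apply: ler_sum => D' /andP[_ lowD]; rewrite mulrCA ler_wpM2l // Tlow.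
rewrite (partition_big (fun D' => inord (k - #|D :&: D'|) : 'I_k.+1)
  (fun j : 'I_k.+1 => 16 * j < k)%N) /=; last first.
  move=> D' /andP[_]; rewrite /low -ltnNge inordK ?ltnS ?leq_subr //.
  by move: (ik D'); move: #|_| => i; lia.
apply: (@le_trans _ _ (\sum_(j < k.+1 | (16 * j < k)%N) k%:R * h)).
  apply: ler_sum => j jk.
  have condE D' : (#|D'| == k) && ~~ low D' && (inord (k - #|D :&: D'|) == j) ->
      (k - #|D :&: D'|)%N = j.
    by case/andP=> _ /eqP <-; rewrite inordK // ltnS leq_subr.
  case: (lerP 0 (T (k - j)%N)) => [T0|T0]; last first.
    apply: (@le_trans _ _ 0); last by rewrite mulr_ge0.
    apply: sumr_le0 => D' /condE ij.
    have -> : #|D :&: D'| = (k - j)%N by have := ik D'; lia.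
    by rewrite mulr_ge0_le0 // ltW.
  apply: (@le_trans _ _ (\sum_(D' : {set 'I_n} | (#|D'| == k) && ((k - #|D :&: D'|)%N == j))
      k%:R * T (k - j)%N)).
    rewrite [leLHS]big_mkcond [leRHS]big_mkcond; apply: ler_sum => D' _.
    case: ifP => [cond|_]; last by case: ifP => // _; rewrite mulr_ge0.
    have ij := condE _ cond; rewrite ij eqxx andbT.
    case/andP: cond => /andP[-> _] _.
    have -> : #|D :&: D'| = (k - j)%N by have := ik D'; lia.
    by rewrite ler_wpM2r // ler_nat leq_subr.
  rewrite sumr_const -[leLHS]mulr_natl mulrCA; apply: ler_wpM2l => //.
  apply: le_trans (Thigh j jk); apply: ler_wpM2r => //.
  by rewrite -natrX ler_nat; have := card_far_sets j cD; rewrite cardsE.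
rewrite sumr_const -[leLHS]mulr_natl mulrA; apply: ler_wpM2r => //.
rewrite expr2 -!natrM ler_nat; apply: leq_mul => //; apply: leq_trans kn.
rewrite -sum1_card; apply: (@leq_trans (\sum_(j < k.+1 | j != ord_max) 1)).
  rewrite [leqLHS]big_mkcond [leqRHS]big_mkcond /=; apply: leq_sum => j _.
  rewrite unfold_in; case: ifP => // jk; case: eqP => // jmax.
  by move: jk; rewrite jmax /=; lia.
by rewrite sum1_card cardC1 card_ord.
Qed.

End Overlap.

Section FiniteBound.
Variables (R : realType) (n k : nat) (p : R).
Let q := (1 - p) ^+ k.
Let th := (1 - p)^-1.
Let e : R := expR 1.
Let U := complete_graph n.
Let P1 := dom_prob n k p.

Lemma expR_le_1sub (y : R) : 0 <= y <= 2^-1 -> expR (- (y + 2 * y ^+ 2)) <= 1 - y.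
Proof.
move=> /andP[y0 y1]; have h : 0 < 1 - y by lra.
apply: (@le_trans _ _ (expR (- (y / (1 - y))))).
  rewrite ler_expR lerN2 ler_pdivrMr //.
  have : 0 <= y ^+ 2 * (1 - 2 * y) by rewrite mulr_ge0 ?sqr_ge0 //; lra.
  by rewrite !expr2; lra.
rewrite expRN -[leRHS]invrK lef_pV2 ?posrE ?invr_gt0 ?expR_gt0 //.
apply: le_trans (expR_ge1Dx _); rewrite le_eqVlt; apply/orP; left; apply/eqP.
by field; lra.
Qed.

Hypothesis p01 : 0 < p < 1.
Hypothesis k0 : (0 < k)%N.
Hypothesis kn : (2 * k <= n)%N.
Hypothesis q_half : q <= 2^-1.
Hypothesis kq : k%:R <= n%:R * q.

Let r01 : 0 < 1 - p < 1.
Proof. by case/andP: p01 => a b; rewrite subr_gt0 b gtrBl. Qed.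
Let r0 : 0 <= 1 - p. Proof. by case/andP: r01 => /ltW. Qed.
Let r1 : 1 - p <= 1. Proof. by case/andP: r01 => _ /ltW. Qed.
Let q0 : 0 < q. Proof. by rewrite exprn_gt0 //; case/andP: r01. Qed.
Let th1 : 1 <= th. Proof. by case/andP: r01 => a b; rewrite invf_ge1 // ltW. Qed.
Let P1_gt0 : 0 < P1.
Proof. by apply: exprn_gt0; have := q_half; rewrite -/q; lra. Qed.
Let n0 : (0 < n)%N. Proof. by apply: leq_trans kn; rewrite muln_gt0. Qed.
Let nR0 : 0 < n%:R :> R. Proof. by rewrite ltr0n. Qed.

Let p01' : 0 <= p <= 1. Proof. by case/andP: p01 => /ltW -> /ltW ->. Qed.

Lemma dom_prob_ge : expR (- (n%:R * q + 2 * n%:R * q ^+ 2)) <= P1.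
Proof.
apply: (@le_trans _ _ ((1 - q) ^+ n)).
  have -> : - (n%:R * q + 2 * n%:R * q ^+ 2) = n%:R * (- (q + 2 * q ^+ 2)) by ring.
  rewrite expRM_natl; apply: lerXn2r; rewrite ?nnegrE ?expR_ge0 //.
    by have := q_half; lra.
  by apply: expR_le_1sub; rewrite ltW.
rewrite /P1 /dom_prob -/q; apply: ler_wiXn2l; last exact: leq_subr.
  by have := q_half; lra.
by rewrite gerBl ltW.
Qed.

Lemma pair_factor_exp_le i : (i <= k)%N ->
  pair_factor p k i ^+ (n - (2 * k - i)) <=
  P1 ^+ 2 * expR (8 * n%:R * q ^+ 2 + n%:R * (1 - p) ^+ (2 * k - i)).
Proof.
move=> ik; set r := (1 - p) ^+ (2 * k - i).
have rr : 0 <= r by apply: exprn_ge0.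
have k2i : (k <= 2 * k - i)%N by clear -ik; lia.
have rq : r <= q by apply: ler_wiXn2l.
apply: (@le_trans _ _ (expR (- 2 * n%:R * q + 4 * k%:R * q + n%:R * r))).
  apply: (@le_trans _ _ (expR (r - 2 * q) ^+ (n - (2 * k - i)))).
    apply: lerXn2r; rewrite ?nnegrE ?expR_ge0 ?pair_factor_ge0 //.
    by apply: le_trans (expR_ge1Dx _); rewrite /pair_factor -/q -/r; lra.
  rewrite -expRM_natl ler_expR natrB; last by apply: leq_trans kn; apply: leq_subr.
  have : (2 * k - i)%:R <= 2 * k%:R :> R by rewrite -natrM ler_nat leq_subr.
  have : 0 <= (2 * k - i)%:R :> R by [].
  move: (2 * k - i)%:R => m m0 mk.
  have : m * (2 * q - r) <= 2 * k%:R * (2 * q).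
    apply: ler_pM => //; lra.
  by rewrite mulrBl; lra.
have P2 : expR (- (2 * n%:R * q + 4 * n%:R * q ^+ 2)) <= P1 ^+ 2.
  have -> : - (2 * n%:R * q + 4 * n%:R * q ^+ 2) =
     2%:R * - (n%:R * q + 2 * n%:R * q ^+ 2) by ring.
  by rewrite expRM_natl lerXn2r ?nnegrE ?expR_ge0 ?dom_prob_ge // ltW.
apply: le_trans (_ : expR (- (2 * n%:R * q + 4 * n%:R * q ^+ 2)) *
   expR (8 * n%:R * q ^+ 2 + n%:R * r) <= _); last by rewrite ler_wpM2r // expR_ge0.
rewrite -expRD ler_expR.
have : 4 * k%:R * q <= 4 * n%:R * q ^+ 2.
  by have := ler_wpM2r (ltW q0) kq; rewrite !expr2; lra.
lra.
Qed.

Hypothesis nq2 : 8 * n%:R * q ^+ 2 <= 1.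
Hypothesis low : forall i, (16 * i <= 15 * k)%N -> 9 * n%:R * q ^+ 2 * th ^+ i <= 1 + i%:R.
Hypothesis high : forall j, (16 * j < k)%N ->
  n%:R ^+ (2 * j + 10) * expR (1 + n%:R * q * (1 - p) ^+ j) <= 'C(n, k)%:R.
Hypothesis k2n : 4 * (e * th) * k%:R ^+ 2 <= n%:R.

Let r_th i : (i <= k)%N -> (1 - p) ^+ (2 * k - i) = q ^+ 2 * th ^+ i.
Proof.
move=> ik; have r_neq0 : (1 - p) ^+ i != 0 by case/andP: r01 => a _; rewrite expf_neq0 // gt_eqF.
apply: (mulIf r_neq0); rewrite -exprD subnK; last by clear -ik; lia.
by rewrite /th exprVn mulfVK // /q -exprM mulnC.
Qed.

Lemma low_bound i : (16 * i <= 15 * k)%N ->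
  pair_factor p k i ^+ (n - (2 * k - i)) <= P1 ^+ 2 * expR (9 * n%:R * q ^+ 2 * th ^+ i).
Proof.
move=> il; have ik : (i <= k)%N by clear -il; lia.
apply: le_trans (pair_factor_exp_le ik) _; rewrite ler_wpM2l ?sqr_ge0 // ler_expR r_th //.
have : 0 <= n%:R * q ^+ 2 by rewrite mulr_ge0 // sqr_ge0.
have : 1 <= th ^+ i by rewrite exprn_ege1.
move: (th ^+ i) => a a1 b0.
have : 0 <= 8 * (n%:R * q ^+ 2) * (a - 1) by rewrite mulr_ge0 ?subr_ge0 // mulr_ge0.
lra.
Qed.

Let expn1 i : expR (1 + i%:R) = e * e ^+ i.
Proof. by rewrite expRD -[i%:R]mulr1 expRM_natl. Qed.

Lemma low_bound1 i : (16 * i <= 15 * k)%N ->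
  pair_factor p k i ^+ (n - (2 * k - i)) - P1 ^+ 2 <=
  P1 ^+ 2 * (9 * e * n%:R * q ^+ 2) * (e * th) ^+ i.
Proof.
move=> il; apply: (@le_trans _ _ (P1 ^+ 2 * (expR (9 * n%:R * q ^+ 2 * th ^+ i) - 1))).
  by rewrite mulrBr mulr1 lerD2r low_bound.
rewrite -[leRHS]mulrA; apply: ler_wpM2l; first exact: sqr_ge0.
set a := 9 * n%:R * q ^+ 2 * th ^+ i.
have a0 : 0 <= a by rewrite !mulr_ge0 ?exprn_ge0 ?sqr_ge0 // (le_trans _ th1).
have -> : 9 * e * n%:R * q ^+ 2 * (e * th) ^+ i = a * (e * e ^+ i).
  rewrite exprMn /a; ring.
apply: (@le_trans _ _ (a * expR a)); last first.
  by rewrite ler_wpM2l // -expn1 ler_expR low.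
have := expR_ge1Dx (- a); rewrite expRN => h.
have ea := expR_gt0 a.
have : (1 - a) * expR a <= 1.
  by rewrite -(@ler_pM2r _ (expR a)^-1) ?invr_gt0 // mulfK ?gt_eqF // mul1r.
lra.
Qed.

Lemma low_bound2 i : (16 * i <= 15 * k)%N ->
  th ^+ i * pair_factor p k i ^+ (n - (2 * k - i)) <= P1 ^+ 2 * e * (e * th) ^+ i.
Proof.
move=> il; have th0 : 0 <= th ^+ i by rewrite exprn_ge0 // (le_trans _ th1).
have -> : P1 ^+ 2 * e * (e * th) ^+ i = th ^+ i * (P1 ^+ 2 * (e * e ^+ i)).
  by rewrite exprMn; move: (th ^+ i) (e ^+ i) => a b; ring.
apply: ler_wpM2l => //; apply: le_trans (low_bound il) _.
by rewrite ler_wpM2l ?sqr_ge0 // -expn1 ler_expR low.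
Qed.

Lemma high_bound j : (16 * j < k)%N ->
  n%:R ^+ (2 * j) * (th ^+ (k - j) *
    pair_factor p k (k - j) ^+ (n - (2 * k - (k - j)))) <=
  P1 ^+ 2 * 'C(n, k)%:R / n%:R ^+ 9.
Proof.
move=> jk; rewrite ler_pdivlMr ?exprn_gt0 //.
have := pair_factor_exp_le (leq_subr j k).
have -> : (2 * k - (k - j) = k + j)%N by clear -jk; lia.
rewrite exprD -/q => h.
have thn : th ^+ (k - j) <= n%:R.
  apply: (@le_trans _ _ (th ^+ k)); first by rewrite ler_weXn2l // leq_subr.
  rewrite /th exprVn -/q -[leLHS]mul1r ler_pdivrMr //.
  by apply: le_trans kq; rewrite ler1n.
have th0 : 0 <= th ^+ (k - j) by rewrite exprn_ge0 // (le_trans _ th1).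
apply: (@le_trans _ _ (n%:R ^+ (2 * j) * (n%:R * (P1 ^+ 2 *
   expR (1 + n%:R * q * (1 - p) ^+ j))) * n%:R ^+ 9)).
  rewrite ler_wpM2r ?exprn_ge0 // ler_wpM2l ?exprn_ge0 //; apply: ler_pM => //.
    by rewrite exprn_ge0 // pair_factor_ge0 // leq_subr.
  apply: le_trans h _; rewrite ler_wpM2l ?sqr_ge0 // ler_expR mulrA.
  by have := nq2; lra.
have -> : n%:R ^+ (2 * j) * (n%:R * (P1 ^+ 2 *
   expR (1 + n%:R * q * (1 - p) ^+ j))) * n%:R ^+ 9 =
   P1 ^+ 2 * (n%:R ^+ (2 * j + 10) * expR (1 + n%:R * q * (1 - p) ^+ j)).
  rewrite exprD; move: (expR _) (n%:R ^+ (2 * j)) => a b; ring.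
by rewrite ler_wpM2l ?sqr_ge0 // high.
Qed.

Let kn' : (0 < k <= n)%N. Proof. by rewrite k0 /=; clear -kn; lia. Qed.
Let e1 : 1 <= e. Proof. by rewrite -expR0 ler_expR. Qed.
Let e0 : 0 <= e. Proof. exact: expR_ge0. Qed.
Let z1 : 1 <= e * th. Proof. by apply: le_trans e1 _; rewrite ler_peMr // (le_trans _ e1). Qed.
Let h0 : 0 <= P1 ^+ 2 * 'C(n, k)%:R / n%:R ^+ 9.
Proof. by apply: divr_ge0; [apply: mulr_ge0; rewrite ?sqr_ge0|exact: exprn_ge0]. Qed.

Let small_term : n%:R ^+ 2 * (P1 ^+ 2 * 'C(n, k)%:R / n%:R ^+ 9) <=
  'C(n, k)%:R * P1 ^+ 2 / n%:R ^+ 7.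
Proof.
rewrite le_eqVlt; apply/orP; left; apply/eqP; field.
by rewrite pnatr_eq0 -lt0n.
Qed.

Let q_ge : n%:R^-1 <= q.
Proof.
rewrite -[leLHS]mul1r ler_pdivrMr // mulrC.
by apply: le_trans kq; rewrite ler1n.
Qed.

Lemma variance_sum : \sum_(D : {set 'I_n} | #|D| == k) \sum_(D' : {set 'I_n} | #|D'| == k)
    #|D :&: D'|%:R *
    (pair_factor p k #|D :&: D'| ^+ (n - (2 * k - #|D :&: D'|)) - P1 ^+ 2)
  <= ('C(n, k)%:R * P1) ^+ 2 * (37 * e ^+ 2 * th * k%:R ^+ 2 * q ^+ 2).
Proof.
pose T i := pair_factor p k i ^+ (n - (2 * k - i)) - P1 ^+ 2.
have inner (D : {set 'I_n}) : #|D| = k -> \sum_(D' : {set 'I_n} | #|D'| == k) #|D :&: D'|%:R * T #|D :&: D'|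
   <= 'C(n, k)%:R * P1 ^+ 2 * (37 * e ^+ 2 * th * k%:R ^+ 2 * q ^+ 2).
  move=> kD; apply: le_trans (@sum_overlap n k R T (P1 ^+ 2 * (9 * e * n%:R * q ^+ 2))
    (e * th) (P1 ^+ 2 * 'C(n, k)%:R / n%:R ^+ 9) D kD kn' z1 _ h0 k2n low_bound1 _) _.
  - by rewrite mulr_ge0 ?sqr_ge0 // mulr_ge0 ?sqr_ge0 // !mulr_ge0.
  - move=> j jk; apply: le_trans (high_bound jk); rewrite ler_wpM2l ?exprn_ge0 //.
    have pf0 : 0 <= pair_factor p k (k - j) ^+ (n - (2 * k - (k - j))).
      by rewrite exprn_ge0 // pair_factor_ge0 // leq_subr.
    apply: (@le_trans _ _ (pair_factor p k (k - j) ^+ (n - (2 * k - (k - j))))).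
      by rewrite /T gerBl sqr_ge0.
    by rewrite ler_peMl // exprn_ege1.
  apply: le_trans (lerD (lexx _) small_term) _.
  have -> : 'C(n, k)%:R * (P1 ^+ 2 * (9 * e * n%:R * q ^+ 2) *
      (4 * (e * th) * k%:R ^+ 2 / n%:R)) =
    'C(n, k)%:R * P1 ^+ 2 * (36 * e ^+ 2 * th * k%:R ^+ 2 * q ^+ 2).
    by field; rewrite pnatr_eq0 -lt0n.
  rewrite -mulrDr; apply: ler_wpM2l; first by rewrite mulr_ge0 ?sqr_ge0.
  have : (n%:R ^+ 7)^-1 <= e ^+ 2 * th * k%:R ^+ 2 * q ^+ 2.
    apply: (@le_trans _ _ (1 * 1 * 1 * (n%:R^-1) ^+ 2)).
      rewrite !mul1r -exprVn; apply: ler_wiXn2l; rewrite ?invr_ge0 //.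
      by rewrite invf_le1 // ler1n.
    apply: ler_pM; rewrite ?sqr_ge0 ?mulr_ge0 //; last first.
      by rewrite lerXn2r ?nnegrE ?invr_ge0 // ltW.
    apply: ler_pM => //; last by rewrite exprn_ege1 // ler1n.
    by apply: ler_pM => //; rewrite exprn_ege1.
  lra.
apply: le_trans (_ : \sum_(D : {set 'I_n} | #|D| == k)
    ('C(n, k)%:R * P1 ^+ 2 * (37 * e ^+ 2 * th * k%:R ^+ 2 * q ^+ 2)) <= _).
  by apply: ler_sum => D /eqP kD; apply: inner.
have <- : #|[set D : {set 'I_n} | #|D| == k]| = 'C(n, k) by rewrite card_draws card_ord.
rewrite sumr_const -[leLHS]mulr_natl cardsE le_eqVlt; apply/orP; left; apply/eqP; ring.
Qed.

Lemma weak_sum : \sum_(D : {set 'I_n} | #|D| == k) \sum_(D' : {set 'I_n} | #|D'| == k)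
    #|D :&: D'|%:R * (th ^+ #|D :&: D'| *
     pair_factor p k #|D :&: D'| ^+ (n - (2 * k - #|D :&: D'|)))
  <= ('C(n, k)%:R * P1) ^+ 2 * (5 * e ^+ 2 * th * k%:R ^+ 2 / n%:R).
Proof.
pose T i := th ^+ i * pair_factor p k i ^+ (n - (2 * k - i)).
have inner (D : {set 'I_n}) : #|D| = k -> \sum_(D' : {set 'I_n} | #|D'| == k) #|D :&: D'|%:R * T #|D :&: D'|
   <= 'C(n, k)%:R * P1 ^+ 2 * (5 * e ^+ 2 * th * k%:R ^+ 2 / n%:R).
  move=> kD; apply: le_trans (@sum_overlap n k R T (P1 ^+ 2 * e)
    (e * th) (P1 ^+ 2 * 'C(n, k)%:R / n%:R ^+ 9) D kD kn' z1 _ h0 k2n low_bound2 high_bound) _.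
    by rewrite mulr_ge0 ?sqr_ge0.
  apply: le_trans (lerD (lexx _) small_term) _.
  have -> : 'C(n, k)%:R * (P1 ^+ 2 * e * (4 * (e * th) * k%:R ^+ 2 / n%:R)) =
    'C(n, k)%:R * P1 ^+ 2 * (4 * e ^+ 2 * th * k%:R ^+ 2 / n%:R).
    by field; rewrite pnatr_eq0 -lt0n.
  rewrite -mulrDr; apply: ler_wpM2l; first by rewrite mulr_ge0 ?sqr_ge0.
  have : (n%:R ^+ 7)^-1 <= e ^+ 2 * th * k%:R ^+ 2 / n%:R.
    apply: (@le_trans _ _ (1 * 1 * 1 * (n%:R^-1) ^+ 1)).
      rewrite !mul1r -exprVn; apply: ler_wiXn2l; rewrite ?invr_ge0 //.
      by rewrite invf_le1 // ler1n.
    rewrite expr1 ler_pM2r ?invr_gt0 //.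
    apply: ler_pM => //; last by rewrite exprn_ege1 // ler1n.
    by apply: ler_pM => //; rewrite exprn_ege1.
  lra.
apply: le_trans (_ : \sum_(D : {set 'I_n} | #|D| == k)
    ('C(n, k)%:R * P1 ^+ 2 * (5 * e ^+ 2 * th * k%:R ^+ 2 / n%:R)) <= _).
  by apply: ler_sum => D /eqP kD; apply: inner.
have <- : #|[set D : {set 'I_n} | #|D| == k]| = 'C(n, k) by rewrite card_draws card_ord.
rewrite sumr_const -[leLHS]mulr_natl cardsE le_eqVlt; apply/orP; left; apply/eqP; ring.
Qed.

Lemma Ex_weak_le x : 0 < x <= 1 ->
  Ex p U (fun E => \sum_u \sum_v weak_count k x u v E ^+ 2) <=
  20 * e ^+ 2 * th * (1 - p + p * x) ^+ (2 * k) * k%:R ^+ 2 * ('C(n, k)%:R * P1) ^+ 2.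
Proof.
move=> /andP[x0 x1]; set rho := 1 - p + p * x.
have [pp0 pp1] : 0 < p /\ p < 1 by case/andP: p01.
have rho_r : 1 - p <= rho by rewrite lerDl mulr_ge0 ?(ltW x0) ?(ltW pp0).
have rho0 : 0 < rho by apply: lt_le_trans rho_r; case/andP: r01.
have -> : 20 * e ^+ 2 * th * rho ^+ (2 * k) * k%:R ^+ 2 * ('C(n, k)%:R * P1) ^+ 2 =
  4 * n%:R * rho ^+ (2 * k) * (('C(n, k)%:R * P1) ^+ 2 * (5 * e ^+ 2 * th * k%:R ^+ 2 / n%:R)).
  by field; rewrite pnatr_eq0 -lt0n.
apply: (@le_trans _ _ (4 * n%:R * rho ^+ (2 * k) *
  \sum_(D : {set 'I_n} | #|D| == k) \sum_(D' : {set 'I_n} | #|D'| == k)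
    #|D :&: D'|%:R * (th ^+ #|D :&: D'| *
     pair_factor p k #|D :&: D'| ^+ (n - (2 * k - #|D :&: D'|))))); last first.
  by apply: ler_wpM2l weak_sum; rewrite !mulr_ge0 // exprn_ge0 // ltW.
apply: le_trans (@Ex_weak_count n k R p p01' x _) _; first by rewrite ltW.
rewrite mulr_sumr; apply: ler_sum => D /eqP kD.
rewrite mulr_sumr; apply: ler_sum => D' _.
rewrite [leRHS]mulrCA; apply: ler_wpM2l => //.
have ik : (#|D :&: D'| <= k)%N by rewrite -kD subset_leq_card // subsetIl.
move: #|D :&: D'| ik => i ik.
have -> : 4 * n%:R * rho ^+ (2 * k) * (th ^+ i * pair_factor p k i ^+ (n - (2 * k - i)))
  = n%:R * ((rho ^+ (2 * k) * th ^+ i) * (4 * pair_factor p k i ^+ (n - (2 * k - i)))).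
  by move: (rho ^+ _) (_ ^+ (n - _)) (th ^+ i) => a b c; ring.
apply: ler_wpM2l => //; apply: ler_pM.
- by rewrite exprn_ge0 // ltW.
- by rewrite exprn_ge0 // pair_factor_ge0.
- rewrite -ler_pdivrMl ?exprn_gt0 // mulrC.
  rewrite -[X in _ / rho ^+ X](@subnK i); last by clear -ik; lia.
  rewrite exprD invfM mulrA divff ?expf_neq0 ?gt_eqF // mul1r -exprVn.
  apply: lerXn2r; rewrite ?nnegrE ?invr_ge0 ?(ltW rho0) // /th ?invr_ge0 //.
  by rewrite lef_pV2 ?posrE //; case/andP: r01.
have pf4 : 4^-1 <= pair_factor p k i.
  apply: le_trans (pair_factor_ge p01' ik); rewrite -/q.
  by have := q_half; rewrite expr2; nra.
have pf0 := pair_factor_ge0 p01' ik.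
case: (n - (2 * k - i))%N => [|m] /=; first by rewrite !expr0; lra.
rewrite exprS mulrA ler_peMl ?exprn_ge0 //; lra.
Qed.

Lemma Pr_robust t L x : (0 < t)%N -> (0 < L)%N -> 0 < x <= 1 ->
  (32 * k * t <= n * L)%N ->
  1 - (16 * 37 * e ^+ 2 * th * k%:R * n%:R * q ^+ 2 +
       16 * 16 * 10 * e ^+ 2 * th * t%:R * k%:R ^+ 2 * (1 - p + p * x) ^+ (2 * k) / x ^+ (2 * L))
  <= Pr p U (robustly_dominated k t).
Proof.
move=> t0 L0 x01 tL; have /andP[x0 x1] := x01.
pose mu := 'C(n.-1, k.-1)%:R * P1.
have kn1 : n%:R * mu = k%:R * 'C(n, k)%:R * P1.
  rewrite /mu mulrA -!natrM; congr (_%:R * _).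
  by rewrite mul_bin_diag prednK.
have kR0 : 0 < k%:R :> R by rewrite ltr0n.
have C0 : 0 < 'C(n, k)%:R :> R by rewrite ltr0n bin_gt0; case/andP: kn'.
have mu0 : 0 < mu by rewrite -(@pmulr_rgt0 _ n%:R) // kn1 !mulr_gt0.
pose V (E : edge_set n) := \sum_u (dom_count k R u E - mu) ^+ 2.
pose Y (E : edge_set n) := \sum_u \sum_v weak_count k x u v E ^+ 2.
pose bad1 := fun E : edge_set n => mu ^+ 2 * n%:R / (16 * k%:R) < V E.
pose bad2 := fun E : edge_set n => x ^+ (2 * L) * (n%:R * mu) ^+ 2 < 128 * t%:R * k%:R ^+ 2 * Y E.
have V0 E : 0 <= V E by apply: sumr_ge0 => u _; apply: sqr_ge0.
have Y0 E : 0 <= Y E by apply: sumr_ge0 => u _; apply: sumr_ge0 => v _; apply: sqr_ge0.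
have CE : 'C(n, k)%:R * P1 = n%:R * mu / k%:R.
  by rewrite kn1; field; apply: lt0r_neq0.
have tR0 : 0 < t%:R :> R by rewrite ltr0n.
have a1 : 0 < mu ^+ 2 * n%:R / (16 * k%:R).
  by apply: divr_gt0; apply: mulr_gt0 => //; apply: exprn_gt0.
have a2 : 0 < 128 * t%:R * k%:R ^+ 2 :> R.
  by apply: mulr_gt0; [apply: mulr_gt0 | apply: exprn_gt0].
have a3 : 0 < x ^+ (2 * L) * (n%:R * mu) ^+ 2.
  by apply: mulr_gt0; apply: exprn_gt0 => //; apply: mulr_gt0.
rewrite lerBlDr -lerBlDl -Pr_predC.
apply: (@le_trans _ _ (Pr p U (predU bad1 bad2))).
  apply: le_Pr => // E _ /=; apply: contraR; rewrite negb_or /bad1 /bad2 -!leNgt.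
  case/andP=> hV hY.
  exact: (@robustly_dominated_of_moments n k R E t L x mu).
apply: le_trans (Pr_predU p01' _ _ _) _; apply: lerD.
  apply: (@le_trans _ _ (Ex p U V / (mu ^+ 2 * n%:R / (16 * k%:R)))).
    by apply: markov_Ex => // E _ /ltW.
  rewrite ler_pdivrMr //.
  apply: le_trans (@Ex_dom_count_variance n k R p p01' k0) _.
  apply: le_trans variance_sum _.
  rewrite CE le_eqVlt; apply/orP; left; apply/eqP; field; exact: lt0r_neq0.
apply: (@le_trans _ _ (Ex p U Y / (x ^+ (2 * L) * (n%:R * mu) ^+ 2 / (128 * t%:R * k%:R ^+ 2)))).
  apply: markov_Ex => // [|E _ /ltW]; first exact: divr_gt0.
  by rewrite ler_pdivrMr // [Y E * _]mulrC.
rewrite ler_pdivrMr; last exact: divr_gt0.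
apply: le_trans (Ex_weak_le x01) _; rewrite CE.
rewrite le_eqVlt; apply/orP; left; apply/eqP; field.
by rewrite !lt0r_neq0 ?exprn_gt0.
Qed.

End FiniteBound.

(** * The edge density *)

Lemma expR1_le4 (R : realType) : expR 1 <= 4 :> R.
Proof.
have -> : 1 = 2%:R * 2^-1 :> R by field.
rewrite expRM_natl; have := @expR_sub1_le R 2^-1; have := expR_gt0 (2^-1 : R).
move: (expR _) => z z0 h; have {}h : z - 1 <= 2 * 2^-1 by apply: h; lra.
by rewrite expr2; nra.
Qed.

Lemma Bernoulli_le (R : realFieldType) (w : R) j : 0 <= w <= 1 -> 1 - j%:R * w <= (1 - w) ^+ j.
Proof.
move=> /andP[w0 w1]; elim: j => [|j IH]; first by rewrite mul0r subr0 expr0.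
rewrite exprS; apply: (@le_trans _ _ ((1 - w) * (1 - j%:R * w))); last first.
  by rewrite ler_wpM2l // subr_ge0.
have : 0 <= j%:R * w ^+ 2 by rewrite mulr_ge0 // sqr_ge0.
rewrite -natr1 expr2; lra.
Qed.

(* [weak_weight] and [sparse_rate] are the constants [x] and [c] such that, with
   [L] about [c * ln n], the loss [(1 - p + p * x) ^+ (2 * k) / x ^+ (2 * L)] is at
   most [(1 - p) ^+ (2 * k) * n ^ (3 eps / 4)]. *)
Definition weak_weight (R : realType) (eps : R) : R := eps / (8 * expR (2 / eps)).

Definition sparse_rate (R : realType) (eps : R) : R :=
  eps / 4 / (2 * ln (weak_weight eps)^-1).

Definition bondage_const (R : realType) (eps : R) : R := sparse_rate eps / (128 * 56).

Lemma weak_weight_bounds (R : realType) (eps : R) :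
  0 < eps -> eps < 3^-1 -> 0 < weak_weight eps < 1.
Proof.
move=> eps0 eps3; have Th1 : 1 <= expR (2 / eps) by rewrite -expR0 ler_expR divr_ge0 // ltW.
rewrite /weak_weight divr_gt0 //=; last lra.
by rewrite ltr_pdivrMr; lra.
Qed.

Lemma sparse_rate_gt0 (R : realType) (eps : R) :
  0 < eps -> eps < 3^-1 -> 0 < sparse_rate eps.
Proof.
move=> eps0 eps3; have /andP[x0 x1] := weak_weight_bounds eps0 eps3.
by rewrite /sparse_rate !divr_gt0 // mulr_gt0 // ln_gt0 // invf_gt1.
Qed.

Section EdgeProbability.
Variables (R : realType) (eps : R) (n k : nat).
Let l : R := ln n%:R.
Let K : R := k%:R.
Let Th : R := expR (2 / eps).
Let M : R := ln 'C(n, k.-1)%:R + 3 * l.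
Let y : R := (l - ln M) / (K - 1).

(* [(1 - p) ^+ k.-1 = M / n], so that the expected number of dominating sets of
   size [k - 1] is about [exp (- M) * 'C(n, k.-1) = n ^ (- 3)]. *)
Definition edge_prob : R := 1 - expR (- y).
Let p := edge_prob.

Hypothesis eps0 : 0 < eps.
Hypothesis k_ge : eps * l <= K.
Hypothesis k_le : K <= expR ((3^-1 - eps) * l).
Hypothesis l100 : 100 <= l.
Hypothesis epsl : 100 <= eps * l.
Hypothesis l_Th : 2 * Th <= l.
Hypothesis exp1 : 2 * l <= expR (eps * l).
Hypothesis exp2 : 72 * l <= expR (24^-1 * l).
Hypothesis exp3 : 9 * expR (2^-1 / eps) <= expR (12^-1 * l).
Hypothesis exp4 : 24 * Th * l <= expR (3^-1 * l).

Let l0 : 0 < l. Proof. by have := l100; lra. Qed.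
Let K100 : 100 <= K. Proof. by apply: le_trans k_ge. Qed.

Ltac lraK := have := l100; have := K100; have := eps0; have := epsl; lra.

Lemma n_gt0 : (0 < n)%N.
Proof. by rewrite lt0n; apply: contraTneq l0 => nn; rewrite /l nn ln0 ?ltxx. Qed.

Let nE : n%:R = expR l. Proof. by rewrite lnK // posrE ltr0n n_gt0. Qed.
Let nR0 : 0 < n%:R :> R. Proof. by rewrite nE expR_gt0. Qed.

Lemma k_gt0 : (0 < k)%N. Proof. by rewrite -(ltr0n R) -/K; lraK. Qed.

Let k1E : k.-1%:R = K - 1. Proof. by rewrite /K -{2}(prednK k_gt0) -natr1 addrK. Qed.

Lemma eps_lt : eps < 3^-1.
Proof.
have : 1 < expR ((3^-1 - eps) * l) by apply: lt_le_trans k_le; lraK.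
by rewrite expR_gt1 pmulr_lgt0 // subr_gt0.
Qed.

Let Th1 : 1 <= Th.
Proof. by rewrite -expR0 ler_expR divr_ge0 // ltW. Qed.

Lemma k_le_exp : K <= expR (3^-1 * l).
Proof. by apply: le_trans k_le _; rewrite ler_expR ler_pM2r //; have := eps0; lra. Qed.

Lemma k_cube : K ^+ 3 * expR (3 * eps * l) <= n%:R.
Proof.
apply: (@le_trans _ _ (expR ((3^-1 - eps) * l) ^+ 3 * expR (3 * eps * l))).
  rewrite ler_pM2r ?expR_gt0 // lerXn2r ?nnegrE ?expR_ge0 //; lraK.
rewrite -expRM_natl -expRD nE ler_expR; lra.
Qed.

Lemma two_k_le : (2 * k <= n)%N.
Proof.
rewrite -(ler_nat R) natrM -/K nE.
have -> : expR l = expR (3^-1 * l) * expR (2 / 3 * l) by rewrite -expRD; congr expR; lra.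
rewrite mulrC; apply: ler_pM => //; first exact: k_le_exp.
by apply: le_trans (expR_ge1Dx _); lraK.
Qed.

Let k_le_n : (k <= n)%N. Proof. by apply: leq_trans two_k_le; rewrite leq_pmull. Qed.
Let C0 : 0 < 'C(n, k.-1)%:R :> R.
Proof. by rewrite ltr0n bin_gt0 (leq_trans (leq_pred k)). Qed.

Lemma expn_n j : n%:R ^+ j = expR (j%:R * l) :> R.
Proof. by rewrite nE expRM_natl. Qed.

Lemma M_ge : 2 / 3 * K * l <= M.
Proof.
have h : expR (2 / 3 * l * (K - 1)) <= 'C(n, k.-1)%:R.
  have := @bin_ratio_le R n k.-1 k.-1; rewrite leqnn (leq_trans (leq_pred k) k_le_n) subnn bin0.
  move=> /(_ isT) h; rewrite -(@ler_pM2r _ (expR (- (2 / 3 * l * (K - 1))))) ?expR_gt0 //.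
  rewrite -expRD subrr expR0; apply: le_trans h _; rewrite ler_pM2l //.
  rewrite -k1E -mulNr expRM_natr lerXn2r ?nnegrE ?expR_ge0 ?divr_ge0 //.
  rewrite ler_pdivrMr // nE -expRD; apply: (@le_trans _ _ K).
    by rewrite k1E; lra.
  by apply: le_trans k_le_exp _; rewrite ler_expR; lraK.
have : 2 / 3 * l * (K - 1) <= ln 'C(n, k.-1)%:R.
  by rewrite -ler_expR lnK ?posrE.
rewrite /M; lraK.
Qed.

Lemma M_le : M <= 2 * K * l.
Proof.
have : ln 'C(n, k.-1)%:R <= (K - 1) * l.
  rewrite -ler_expR lnK ?posrE // -k1E -expn_n -natrX ler_nat; exact: bin_le_exp.
have : 100 * l <= K * l by rewrite ler_wpM2r // ltW.
rewrite /M; lraK.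
Qed.

Lemma M_le_exp : M <= expR (3^-1 * l).
Proof.
apply: le_trans M_le _; rewrite mulrAC.
apply: (@le_trans _ _ (expR (eps * l) * expR ((3^-1 - eps) * l))).
  by apply: ler_pM => //; lraK.
by rewrite -expRD ler_expR; lra.
Qed.

Let M0 : 0 < M.
Proof. by apply: lt_le_trans M_ge; rewrite !mulr_gt0 //; lraK. Qed.

Lemma lnM_bound : 0 <= ln M <= 3^-1 * l.
Proof.
apply/andP; split.
  rewrite ln_ge0 //; apply: le_trans M_ge.
  have : 1 * 2 <= K * l by apply: ler_pM => //; lraK.
  lra.
by rewrite -ler_expR lnK ?posrE // M_le_exp.
Qed.

Let yK1 : y * (K - 1) = l - ln M. Proof. by rewrite /y mulfVK //; apply: lt0r_neq0; lraK. Qed.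

Lemma y_lower : 2 / 3 * l <= y * (K - 1).
Proof. by rewrite yK1; case/andP: lnM_bound; lraK. Qed.

Lemma y_upper : y * (K - 1) <= l.
Proof. by rewrite yK1; case/andP: lnM_bound; lraK. Qed.

Let y0 : 0 < y.
Proof.
have := y_lower; rewrite -(@pmulr_lgt0 _ (K - 1)); last lraK.
by apply: lt_le_trans; lraK.
Qed.

Lemma y_le_lK : y <= 2 * l / K.
Proof.
rewrite ler_pdivlMr; last lraK.
have : 0 <= y * (K - 2) by rewrite mulr_ge0 ?(ltW y0) //; lraK.
have := y_upper; lra.
Qed.

Lemma y_le_eps : y <= 2 / eps.
Proof.
apply: le_trans y_le_lK _; rewrite ler_pdivrMr; last lraK.
rewrite mulrAC ler_pdivlMr //; have := k_ge; lra.
Qed.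

Lemma yK_le : y * K <= l + 2 / eps.
Proof. by have := y_upper; have := y_le_eps; lra. Qed.

Lemma yK_ge : 2 / 3 * l <= y * K.
Proof. by have := y_lower; have := y0; lra. Qed.

Lemma one_sub_p : 1 - p = expR (- y). Proof. by rewrite /p /edge_prob opprB addrC subrK. Qed.

Lemma one_sub_pX j : (1 - p) ^+ j = expR (- (y * j%:R)).
Proof. by rewrite one_sub_p -expRM_natl mulrN mulrC. Qed.

Lemma p_bounds : 0 < p < 1.
Proof. by rewrite /p /edge_prob subr_gt0 expR_lt1 oppr_lt0 y0 gtrBl expR_gt0. Qed.

Lemma p_le_y : p <= y.
Proof. by rewrite /p /edge_prob; have := expR_ge1Dx (- y); lra. Qed.

Lemma one_sub_exp_ge (w : R) : 0 <= w -> w <= 1 -> w / 2 <= 1 - expR (- w).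
Proof.
move=> w0 w1; rewrite expRN.
have : (expR w)^-1 <= (1 + w)^-1.
  by rewrite lef_pV2 ?posrE ?expR_gt0 ?expR_ge1Dx //; lra.
have -> : (1 + w)^-1 = 1 - w / (1 + w) by field; lra.
have : w / 2 <= w / (1 + w) by rewrite ler_wpM2l // lef_pV2 ?posrE; lra.
lra.
Qed.

Lemma one_sub_exp_ge1 (w : R) : 1 <= w -> 2^-1 <= 1 - expR (- w).
Proof.
move=> w1; have := @one_sub_exp_ge 1 ler01 (lexx 1).
have : expR (- w) <= expR (- 1) by rewrite ler_expR lerN2.
lra.
Qed.

Let q := (1 - p) ^+ k.

Lemma nq_E : n%:R * q = expR (- y) * M.
Proof.
rewrite /q -(prednK k_gt0) exprS one_sub_pX k1E yK1 one_sub_p.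
have -> : expR (- (l - ln M)) = M / n%:R.
  by rewrite opprB expRD expRN -nE lnK ?posrE.
by field; apply: lt0r_neq0.
Qed.

Lemma q_le : q <= expR (- (2 / 3 * l)).
Proof. by rewrite /q one_sub_pX ler_expR lerN2 yK_ge. Qed.

Lemma q_le_half : q <= 2^-1.
Proof.
apply: le_trans q_le _; rewrite expRN lef_pV2 ?posrE ?expR_gt0 //.
by apply: le_trans (expR_ge1Dx _); lraK.
Qed.

Let exp_y_Th : expR y <= Th. Proof. by rewrite ler_expR y_le_eps. Qed.

Lemma k_le_nq : K <= n%:R * q.
Proof.
rewrite nq_E expRN -ler_pdivrMl ?invr_gt0 ?expR_gt0 // invrK.
apply: le_trans M_ge.
apply: (@le_trans _ _ (Th * K)).
  by rewrite ler_pM2r ?exp_y_Th //; lraK.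
have : 2 * Th * K <= l * K. by rewrite ler_pM2r ?l_Th //; lraK.
have : 0 <= l * K by rewrite mulr_ge0; lraK.
lra.
Qed.

Let nq_le : n%:R * q <= M.
Proof. by rewrite nq_E ler_piMl ?(ltW M0) // -expR0 ler_expR oppr_le0 ltW. Qed.

Lemma nq2_le : n%:R * q ^+ 2 <= M ^+ 2 / n%:R.
Proof.
rewrite ler_pdivlMr //; have -> : n%:R * q ^+ 2 * n%:R = (n%:R * q) ^+ 2 by ring.
rewrite lerXn2r ?nnegrE ?(ltW M0) // mulr_ge0 ?(ltW nR0) // exprn_ge0 //.
by rewrite one_sub_p expR_ge0.
Qed.

Lemma M2n_le : M ^+ 2 / n%:R <= expR (- (3^-1 * l)).
Proof.
rewrite ler_pdivrMr // nE -expRD; apply: (@le_trans _ _ (expR (3^-1 * l) ^+ 2)).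
  by rewrite lerXn2r ?nnegrE ?expR_ge0 ?M_le_exp // ltW.
by rewrite -expRM_natl ler_expR; lra.
Qed.

Lemma nq2_small : 8 * n%:R * q ^+ 2 <= 1.
Proof.
have := le_trans nq2_le M2n_le.
have : expR (- (3^-1 * l)) <= 8^-1.
  rewrite expRN lef_pV2 ?posrE ?expR_gt0 //.
  by apply: le_trans (expR_ge1Dx _); lraK.
lra.
Qed.

Let th := (1 - p)^-1.
Let thE : th = expR y. Proof. by rewrite /th one_sub_p expRN invrK. Qed.

Lemma low_condition i : (16 * i <= 15 * k)%N -> 9 * n%:R * q ^+ 2 * th ^+ i <= 1 + i%:R.
Proof.
rewrite -(ler_nat R) !natrM -/K => ik.
rewrite thE -expRM_natl; case: (lerP (4 * i%:R) K) => hi.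
  apply: (@le_trans _ _ (9 * (expR (- (3^-1 * l)) * expR (4^-1 * (l + 2 / eps))))).
    have -> : 9 * n%:R * q ^+ 2 * expR (i%:R * y) =
      9 * ((n%:R * q ^+ 2) * expR (i%:R * y)) by ring.
    rewrite ler_pM2l //; apply: ler_pM; rewrite ?expR_ge0 //.
    - by rewrite mulr_ge0 ?(ltW nR0) // sqr_ge0.
    - exact: le_trans nq2_le M2n_le.
    - rewrite ler_expR; have := yK_le; have := ler_wpM2r (ltW y0) hi; lra.
  rewrite -expRD; apply: (@le_trans _ _ 1); last by rewrite lerDl.
  have -> : - (3^-1 * l) + 4^-1 * (l + 2 / eps) = 2^-1 / eps - 12^-1 * l.
    by field; apply: lt0r_neq0.
  rewrite expRD expRN mulrA ler_pdivrMr ?expR_gt0 // mul1r; exact: exp3.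
have -> : 9 * n%:R * q ^+ 2 * expR (i%:R * y) = 9 * ((n%:R * q) * (q * expR (i%:R * y))).
  by ring.
have h : q * expR (i%:R * y) <= expR (- (24^-1 * l)).
  rewrite /q one_sub_pX -expRD ler_expR -/K.
  have := yK_ge; have := ler_wpM2r (ltW y0) ik; lra.
apply: (@le_trans _ _ (9 * (2 * K * l * expR (- (24^-1 * l))))).
  rewrite ler_pM2l //; apply: ler_pM => //.
  - by rewrite mulr_ge0 ?(ltW nR0) // exprn_ge0 // one_sub_p expR_ge0.
  - by rewrite mulr_ge0 ?expR_ge0 // exprn_ge0 // one_sub_p expR_ge0.
  - exact: le_trans nq_le M_le.
have : l * expR (- (24^-1 * l)) <= 72^-1.
  rewrite expRN ler_pdivrMr ?expR_gt0 //; have := exp2; lra.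
move=> hl; have := ler_wpM2l (_ : 0 <= 18 * K) hl; move=> /(_ _) h2.
have := h2 ltac:(lraK); lraK.
Qed.

Lemma bin_pred_le : 'C(n, k.-1)%:R <= 'C(n, k)%:R :> R.
Proof.
rewrite ler_nat -(leq_pmul2l k_gt0).
have := mul_bin_left n k.-1; rewrite prednK ?k_gt0 // => ->.
by rewrite leq_mul2r; apply/orP; right; have := two_k_le; have := k_gt0; clear; lia.
Qed.

Lemma bin_pred_exp : 'C(n, k.-1)%:R = expR (M - 3 * l) :> R.
Proof. by rewrite /M addrK lnK ?posrE. Qed.

Lemma high_condition j : (16 * j < k)%N ->
  n%:R ^+ (2 * j + 10) * expR (1 + n%:R * q * (1 - p) ^+ j) <= 'C(n, k)%:R.
Proof.
rewrite -(ltr_nat R) natrM -/K => jk.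
apply: le_trans bin_pred_le; rewrite bin_pred_exp expn_n -expRD ler_expR.
rewrite nq_E one_sub_pX natrD natrM.
have -> : expR (- y) * M * expR (- (y * j%:R)) = M * expR (- (y * (j%:R + 1))).
  by rewrite mulrAC mulrC -expRD; congr (_ * expR _); ring.
set w := y * (j%:R + 1).
suff : (2 * j%:R + 14) * l <= M * (1 - expR (- w)) by lraK.
have j0 : 0 <= j%:R :> R by [].
have w0 : 0 <= w by rewrite mulr_ge0 ?(ltW y0) // addr_ge0.
case: (lerP w 1) => w1.
  apply: (@le_trans _ _ (M * (w / 2))); last by rewrite ler_wpM2l ?(ltW M0) ?one_sub_exp_ge.
  apply: (@le_trans _ _ (2 / 3 * K * l * (w / 2))); last first.
    by rewrite ler_wpM2r ?M_ge // divr_ge0.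
  have -> : 2 / 3 * K * l * (w / 2) = (y * K) * (l * (j%:R + 1) / 3) by rewrite /w; field.
  apply: (@le_trans _ _ (2 / 3 * l * (l * (j%:R + 1) / 3))); last first.
    by rewrite ler_wpM2r ?yK_ge // divr_ge0 // mulr_ge0 ?addr_ge0 // ltW.
  have : 100 * ((j%:R + 1) * l) <= l * ((j%:R + 1) * l).
    by rewrite ler_wpM2r // mulr_ge0 ?addr_ge0 // ltW.
  by have := mulr_ge0 j0 (ltW l0); have := l0; lra.
apply: (@le_trans _ _ (2 / 3 * K * l * 2^-1)); last first.
  apply: ler_pM; rewrite ?invr_ge0 ?M_ge //.
    by rewrite !mulr_ge0 //; lraK.
  by apply: one_sub_exp_ge1; apply: ltW.
have -> : 2 / 3 * K * l * 2^-1 = (K / 3) * l by field.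
rewrite ler_pM2r //; lraK.
Qed.

Lemma k2n_condition : 4 * (expR 1 * th) * K ^+ 2 <= n%:R.
Proof.
have e4 := expR1_le4 R.
apply: (@le_trans _ _ (4 * (4 * Th) * expR (3^-1 * l) ^+ 2)).
  apply: ler_pM.
  - by rewrite !mulr_ge0 ?expR_ge0 // thE expR_ge0.
  - by rewrite exprn_ge0.
  - rewrite ler_pM2l //; apply: ler_pM; rewrite ?expR_ge0 ?e4 // thE ?expR_ge0 //.
  - by rewrite lerXn2r ?nnegrE ?expR_ge0 ?k_le_exp.
have -> : n%:R = expR (3^-1 * l) * expR (3^-1 * l) ^+ 2.
  by rewrite -exprS -expRM_natl nE; congr expR; field.
rewrite ler_pM2r ?exprn_gt0 ?expR_gt0 //; apply: le_trans exp4.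
have : Th * 1 <= Th * l by rewrite ler_wpM2l ?expR_ge0 //; lraK.
have := Th1; lra.
Qed.

Let a : R := eps / 4.
Let x : R := weak_weight eps.
Let rate : R := sparse_rate eps.
Let L : nat := Num.truncn (rate * l).
Definition deletion_budget : nat := ((n * L) %/ (32 * k))%N.
Let t := deletion_budget.

Hypothesis rate_l : 2 <= rate * l.
Hypothesis exp5 : 64 * (16 * 37 + 80 * rate) * Th * l ^+ 4 <= expR (2 * eps * l).

Let x01 : 0 < x < 1. Proof. exact: weak_weight_bounds eps0 eps_lt. Qed.
Let lnx : 0 < ln x^-1. Proof. by case/andP: x01 => x0 x1; rewrite ln_gt0 // invf_gt1. Qed.
Let rate0 : 0 < rate. Proof. exact: sparse_rate_gt0 eps0 eps_lt. Qed.

Let L_bounds : rate * l / 2 <= L%:R <= rate * l.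
Proof.
have /truncn_itv/andP[] : 0 <= rate * l by rewrite mulr_ge0 // ltW.
rewrite -/L -natr1 => -> h; rewrite andbT; have := rate_l; lra.
Qed.

Lemma k_le_n64 : 64 * K <= n%:R.
Proof.
rewrite nE.
have -> : expR l = expR (3^-1 * l) * expR (2 / 3 * l) by rewrite -expRD; congr expR; field.
rewrite mulrC; apply: ler_pM => //; first exact: k_le_exp.
by apply: le_trans (expR_ge1Dx _); lraK.
Qed.

Lemma budget_ub : (32 * k * t <= n * L)%N.
Proof. by rewrite mulnC; apply: leq_divM. Qed.

Lemma budget_le : t%:R * K <= n%:R * (rate * l) / 32.
Proof.
have := budget_ub; rewrite -(ler_nat R) !natrM -/K => h.
have : n%:R * L%:R <= n%:R * (rate * l).
  by rewrite ler_wpM2l //; case/andP: L_bounds.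
lra.
Qed.

Lemma budget_ge : n%:R * (rate * l) / 128 <= t%:R * K.
Proof.
have h : n%:R * L%:R <= (t%:R + 1) * (32 * K) :> R.
  rewrite /K natr1 -!natrM ler_nat /t /deletion_budget.
  by rewrite ltnW // ltn_ceil // muln_gt0 k_gt0.
have : n%:R * (rate * l / 2) <= n%:R * L%:R.
  by rewrite ler_wpM2l //; case/andP: L_bounds.
have : n%:R * 2 <= n%:R * (rate * l) by rewrite ler_wpM2l // rate_l.
have := k_le_n64; lra.
Qed.

Lemma budget_gt0 : (0 < t)%N.
Proof.
rewrite -(ltr0n R) -(@pmulr_lgt0 _ K); last lraK.
apply: lt_le_trans budget_ge; rewrite divr_gt0 // mulr_gt0 //.
by have := rate_l; lra.
Qed.

Let L_gt0 : (0 < L)%N.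
Proof. by rewrite -(ltr0n R); case/andP: L_bounds => h _; have := rate_l; lra. Qed.

Lemma rho_le : (1 - p + p * x) ^+ (2 * k) <= q ^+ 2 * expR (2 * a * l).
Proof.
have [x0 x1] := andP x01; have [p0 p1] := andP p_bounds.
have -> : 1 - p + p * x = (1 - p) * (1 + p * x * th).
  by rewrite /th; field; apply: lt0r_neq0; lra.
rewrite exprMn mulnC exprM -/q; apply: ler_wpM2l; first exact: sqr_ge0.
have pxth : 0 <= p * x * th by rewrite thE; apply: mulr_ge0; [apply: mulr_ge0; apply: ltW|apply: expR_ge0].
apply: (@le_trans _ _ (expR (p * x * th) ^+ (k * 2))).
  by apply: lerXn2r; rewrite ?nnegrE ?expR_ge0 ?expR_ge1Dx // addr_ge0.
rewrite -expRM_natl ler_expR natrM -/K.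
have thTh : th <= Th by rewrite thE.
have h1 : p * K <= 2 * l.
  apply: (@le_trans _ _ (y * K)); first by rewrite ler_wpM2r ?p_le_y //; lraK.
  by have := y_le_lK; rewrite ler_pdivlMr //; lraK.
have h2 : x * th <= eps / 8.
  apply: (@le_trans _ _ (x * Th)); first by rewrite ler_wpM2l // ltW.
  by rewrite /x /weak_weight -/Th le_eqVlt; apply/orP; left; apply/eqP; field; apply: lt0r_neq0; have := Th1; lra.
have : p * K * (x * th) <= 2 * l * (eps / 8).
  apply: ler_pM => //; first by apply: mulr_ge0; [apply: ltW|].
  by apply: mulr_ge0; [apply: ltW|rewrite thE expR_ge0].
rewrite /a; lra.
Qed.

Lemma xL_ge : expR (- (a * l)) <= x ^+ (2 * L).
Proof.
have [x0 x1] := andP x01.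
have -> : x = expR (- ln x^-1) by rewrite lnV ?posrE // opprK lnK.
rewrite -expRM_natl ler_expR mulrN lerN2 natrM.
have h : rate * (2 * ln x^-1) = a by rewrite /rate /sparse_rate -/x divfK // lt0r_neq0 // mulr_gt0.
have : (2 * ln x^-1) * L%:R <= (2 * ln x^-1) * (rate * l).
  by rewrite ler_wpM2l ?mulr_ge0 ?(ltW lnx) //; case/andP: L_bounds.
have -> : (2 * ln x^-1) * (rate * l) = a * l by rewrite -h; ring.
lra.
Qed.

Lemma nq2_poly : n%:R * q ^+ 2 <= 4 * K ^+ 2 * l ^+ 2 / n%:R.
Proof.
apply: le_trans nq2_le _; rewrite ler_pM2r ?invr_gt0 //.
have -> : 4 * K ^+ 2 * l ^+ 2 = (2 * K * l) ^+ 2 by ring.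
by rewrite lerXn2r ?nnegrE ?(ltW M0) ?M_le // !mulr_ge0 // ltW.
Qed.

Let epsl_le : - (3 * eps * l) <= - (2 * eps * l).
Proof. by rewrite lerN2 ler_pM2r // ler_pM2r // ler_nat. Qed.

Let epsl_le' : - (3 * eps * l) + 3 * a * l <= - (2 * eps * l).
Proof.
have : 0 < eps * l by apply: mulr_gt0.
have -> : 3 * a * l = 3 / 4 * (eps * l) by rewrite /a; field.
rewrite -!mulrA; move: (eps * l) => u u0; lra.
Qed.

Lemma Pr_robust_ge :
  1 - l^-1 <= Pr p (complete_graph n) (robustly_dominated k t).
Proof.
have [x0 x1] := andP x01.
apply: le_trans (@Pr_robust R n k p p_bounds k_gt0 two_k_le q_le_half k_le_nq nq2_small
  low_condition high_condition k2n_condition t L x budget_gt0 L_gt0 _ budget_ub);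
  last by rewrite x0 ltW.
rewrite -/q -/th lerD2l lerN2.
have : 64 * (16 * 37 + 80 * rate) * Th * l ^+ 4 <= expR (2 * eps * l) := exp5.
have -> : 64 * (16 * 37 + 80 * rate) = 64 * (16 * 37) + 4 * (16 * 80) * rate by ring.
have : 16 * 16 * 10 / 2 = 16 * 80 :> R by field.
have : 0 <= 16 * 37 :> R by rewrite mulr_ge0.
have : 0 <= 16 * 16 * 10 :> R by rewrite !mulr_ge0.
move: (16 * 37) (16 * 16 * 10) (16 * 80) => A B B' B0 A0 BB' exp5'.
have B'0 : 0 <= B' by rewrite -BB' divr_ge0.
have K0 : 0 <= K by lraK.
have Th0 : 0 <= Th by exact: expR_ge0.
have eTh : expR 1 ^+ 2 * th <= 16 * Th.
  apply: ler_pM; rewrite ?exprn_ge0 ?expR_ge0 ?thE ?expR_ge0 //.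
  have := expR1_le4 R; have := expR_ge0 (1 : R); rewrite expr2; nra.
have eTh0 : 0 <= expR 1 ^+ 2 * th by rewrite mulr_ge0 ?sqr_ge0 // thE expR_ge0.
pose W := K ^+ 3 * l ^+ 3 / n%:R.
pose F := n%:R * q ^+ 2.
have F0 : 0 <= F by rewrite mulr_ge0 ?sqr_ge0.
have KFl : K * F * l <= 4 * W.
  have -> : 4 * W = K * (4 * K ^+ 2 * l ^+ 2 / n%:R) * l by rewrite /W; ring.
  by rewrite ler_pM2r // ler_wpM2l // nq2_poly.
have KF : K * F <= 4 * W.
  by apply: le_trans KFl; apply: ler_peMr; [apply: mulr_ge0|lraK].
have K3n : K ^+ 3 / n%:R <= expR (- (3 * eps * l)).
  by rewrite ler_pdivrMr // expRN mulrC ler_pdivlMr ?expR_gt0 // k_cube.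
have bound1 : A * expR 1 ^+ 2 * th * K * n%:R * q ^+ 2 <= 64 * A * Th * W.
  have -> : A * expR 1 ^+ 2 * th * K * n%:R * q ^+ 2 =
    A * ((expR 1 ^+ 2 * th) * (K * F)) by rewrite /F; ring.
  have -> : 64 * A * Th * W = A * ((16 * Th) * (4 * W)) by ring.
  by apply: ler_wpM2l => //; apply: ler_pM => //; rewrite mulr_ge0.
have bound2 : B * expR 1 ^+ 2 * th * t%:R * K ^+ 2 * (1 - p + p * x) ^+ (2 * k) / x ^+ (2 * L)
   <= 4 * B' * rate * Th * W * expR (3 * a * l).
  have xL : (x ^+ (2 * L))^-1 <= expR (a * l).
    by rewrite -[leRHS]invrK -expRN lef_pV2 ?posrE ?expR_gt0 ?exprn_gt0 // xL_ge.
  have [p0 p1] := andP p_bounds.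
  have rho0 : 0 <= (1 - p + p * x) ^+ (2 * k).
    by apply: exprn_ge0; apply: addr_ge0; [rewrite subr_ge0 ltW|apply: mulr_ge0; apply: ltW].
  have -> : B * expR 1 ^+ 2 * th * t%:R * K ^+ 2 * (1 - p + p * x) ^+ (2 * k) / x ^+ (2 * L)
    = B * ((expR 1 ^+ 2 * th) * ((t%:R * K * K) *
       ((1 - p + p * x) ^+ (2 * k) * (x ^+ (2 * L))^-1))).
    by move: (_ ^+ (2 * k)) (_ ^+ (2 * L)) => b c; ring.
  apply: (@le_trans _ _ (B * ((16 * Th) * ((n%:R * (rate * l) / 32 * K) *
       ((q ^+ 2 * expR (2 * a * l)) * expR (a * l)))))).
    apply: ler_wpM2l => //; apply: ler_pM => //.
      by rewrite !mulr_ge0 // invr_ge0 exprn_ge0 // ltW.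
    apply: ler_pM.
    - by rewrite !mulr_ge0.
    - by rewrite mulr_ge0 // invr_ge0 exprn_ge0 // ltW.
    - by rewrite ler_wpM2r // budget_le.
    - by apply: ler_pM => //; rewrite ?rho_le // invr_ge0 exprn_ge0 // ltW.
  have -> : expR (3 * a * l) = expR (2 * a * l) * expR (a * l).
    by rewrite -expRD; congr expR; ring.
  have -> : B * (16 * Th * (n%:R * (rate * l) / 32 * K *
     (q ^+ 2 * expR (2 * a * l) * expR (a * l)))) =
    B' * rate * Th * (expR (2 * a * l) * expR (a * l)) * (K * F * l).
    by move: (expR (2 * a * l)) (expR (a * l)) => b c; rewrite /F -BB'; field.
  have -> : 4 * B' * rate * Th * W * (expR (2 * a * l) * expR (a * l)) =
    B' * rate * Th * (expR (2 * a * l) * expR (a * l)) * (4 * W).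
    by move: (expR (2 * a * l)) (expR (a * l)) => b c; ring.
  apply: ler_wpM2l KFl.
  apply: mulr_ge0; last by apply: mulr_ge0; apply: expR_ge0.
  by apply: mulr_ge0 => //; apply: mulr_ge0 => //; apply: ltW.
have Z : (64 * A * Th * W + 4 * B' * rate * Th * W * expR (3 * a * l)) <= l^-1.
  have -> : l^-1 = l ^+ 3 * (l ^+ 4)^-1 by field; apply: lt0r_neq0.
  have WE : W = K ^+ 3 / n%:R * l ^+ 3 by rewrite /W; ring.
  apply: (@le_trans _ _ (l ^+ 3 * ((64 * A + 4 * B' * rate) * Th * expR (- (2 * eps * l))))).
    have r0 := ltW rate0.
    have l3 : 0 <= l ^+ 3 by rewrite exprn_ge0 // ltW.
    have W1 : W <= l ^+ 3 * expR (- (2 * eps * l)).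
      rewrite WE mulrC ler_wpM2l //; apply: le_trans K3n _; by rewrite ler_expR.
    have W2 : W * expR (3 * a * l) <= l ^+ 3 * expR (- (2 * eps * l)).
      rewrite WE mulrAC mulrC ler_wpM2l //.
      apply: (@le_trans _ _ (expR (- (3 * eps * l)) * expR (3 * a * l))).
        by rewrite ler_wpM2r ?expR_ge0.
      by rewrite -expRD ler_expR.
    have h1 := ler_wpM2l (_ : 0 <= 64 * A * Th) W1.
    have h2 := ler_wpM2l (_ : 0 <= 4 * B' * rate * Th) W2.
    have {}h1 := h1 ltac:(by apply: mulr_ge0 => //; apply: mulr_ge0).
    have {}h2 := h2 ltac:(by apply: mulr_ge0 => //; apply: mulr_ge0 => //; apply: mulr_ge0).
    have -> : l ^+ 3 * ((64 * A + 4 * B' * rate) * Th * expR (- (2 * eps * l))) =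
      64 * A * Th * (l ^+ 3 * expR (- (2 * eps * l))) +
      4 * B' * rate * Th * (l ^+ 3 * expR (- (2 * eps * l))) by ring.
    by apply: lerD => //; rewrite -[leLHS]mulrA.
  apply: ler_wpM2l; first by rewrite exprn_ge0 // ltW.
  rewrite expRN ler_pdivrMr ?expR_gt0 // ler_pdivlMl ?exprn_gt0 //.
  by rewrite [leLHS]mulrC; apply: exp5'.
by apply: le_trans Z; apply: lerD.
Qed.

Let N : R := 'C(n, 2)%:R.
Let s : R := n%:R * l.
(* [p] and [pp] are chosen so that [m] exceeds the mean number of edges of G(n,p),
   and falls short of that of G(n,pp), by at least [s = n ln n]. *)
Let dp : R := (2 * s + 1) / N.
Let pp : R := p + dp.
Let m : nat := (Num.truncn (N * p + s)).+1.

Lemma n_large : 24 * l <= n%:R.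
Proof.
apply: (@le_trans _ _ (24 * Th * l)); first by rewrite -mulrA ler_pM2l // ler_peMl // ltW.
by apply: le_trans exp4 _; rewrite nE ler_expR; lraK.
Qed.

Lemma twoN : 2 * N = n%:R * (n%:R - 1).
Proof.
rewrite /N -natrM -mul_bin_diag bin1 natrM; congr (_ * _).
by rewrite -{2}(prednK n_gt0) -natr1 addrK.
Qed.

Let n100 : 100 <= n%:R :> R. Proof. by have := n_large; lraK. Qed.

Let N_ge : n%:R ^+ 2 / 4 <= N.
Proof.
have : 0 <= n%:R * (n%:R - 2) :> R by rewrite mulr_ge0 //; have := n100; lra.
have := twoN; lra.
Qed.

Let N0 : 0 < N. Proof. by apply: lt_le_trans N_ge; rewrite divr_gt0 // exprn_gt0. Qed.

Lemma dp_le : dp <= 12 * l / n%:R.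
Proof.
rewrite /dp ler_pdivrMr // mulrAC ler_pdivlMr //.
have := N_ge; have := l100; have := n100; rewrite /s.
move=> n24 l1 hN; apply: (@le_trans _ _ (12 * l * (n%:R ^+ 2 / 4))); last by rewrite ler_wpM2l //; lra.
have h : 1 <= n%:R * l by rewrite -[leLHS]mulr1 ler_pM //; lra.
have : n%:R * 1 <= n%:R * (n%:R * l) by rewrite ler_wpM2l.
rewrite expr2; lra.
Qed.

Let dp0 : 0 < dp. Proof. by rewrite divr_gt0 // ltr_wpDl // mulr_ge0 // mulr_ge0 // ltW. Qed.

Let w : R := 12 * l * Th / n%:R.

Lemma one_sub_pp : expR (- y) * (1 - w) <= 1 - pp.
Proof.
rewrite /pp opprD addrA one_sub_p mulrBr mulr1 lerD2l lerN2.
apply: le_trans dp_le _; rewrite /w mulrA ler_pM2r ?invr_gt0 //.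
have h : 1 <= expR (- y) * Th by rewrite expRN ler_pdivlMl ?expR_gt0 // mulr1.
have := ler_wpM2l (ltW l0) h; lra.
Qed.

Let pp0 : 0 <= pp.
Proof. by rewrite addr_ge0 ?(ltW dp0) //; case/andP: p_bounds => /ltW. Qed.

Let Mn_le : M * K / n%:R <= expR (- (3^-1 * l)).
Proof.
rewrite ler_pdivrMr // nE -expRD.
apply: (@le_trans _ _ (expR (3^-1 * l) * expR (3^-1 * l))).
  by apply: ler_pM; rewrite ?M_le_exp ?k_le_exp // ltW.
by rewrite -expRD ler_expR; lraK.
Qed.

Let K_n_w : M * K / n%:R + M * K * w <= 1.
Proof.
have e1 : expR (- (3^-1 * l)) <= 2^-1.
  rewrite expRN lef_pV2 ?posrE ?expR_gt0 //.
  by apply: le_trans (expR_ge1Dx _); lraK.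
have h1 : M * K / n%:R <= 2^-1 by apply: le_trans Mn_le e1.
have h2 : M * K * w <= 2^-1; last by lra.
have -> : M * K * w = (M * K / n%:R) * (12 * l * Th) by rewrite /w; ring.
apply: (@le_trans _ _ (expR (- (3^-1 * l)) * (12 * l * Th))).
  by rewrite ler_wpM2r // !mulr_ge0 ?expR_ge0 // ltW.
rewrite expRN ler_pdivrMl ?expR_gt0 //; have := exp4; lra.
Qed.

Let w01 : 0 <= w <= 1.
Proof.
rewrite /w; apply/andP; split; first by rewrite divr_ge0 // !mulr_ge0 ?expR_ge0 // ltW.
rewrite ler_pdivrMr // mul1r; apply: (@le_trans _ _ (expR (3^-1 * l))).
  have Thl : 0 <= Th * l by rewrite mulr_ge0 ?expR_ge0 // ltW.
  by apply: le_trans exp4; lra.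
by rewrite nE ler_expR; lraK.
Qed.

Let pp1 : pp <= 1.
Proof.
have := one_sub_pp; have : 0 <= expR (- y) * (1 - w).
  by rewrite mulr_ge0 ?expR_ge0 // subr_ge0; case/andP: w01.
lra.
Qed.

Lemma Pr_small_domination :
  Pr pp (complete_graph n) (has_dominating k.-1) <= l^-1.
Proof.
apply: le_trans (@Pr_has_dominating n R pp _ k.-1) _; first by rewrite pp0 pp1.
set r := (1 - pp) ^+ k.-1.
have r_ge : M / n%:R * (1 - K * w) <= r.
  apply: (@le_trans _ _ ((expR (- y) * (1 - w)) ^+ k.-1)); last first.
    have : 0 <= expR (- y) * (1 - w).
      by rewrite mulr_ge0 ?expR_ge0 // subr_ge0; case/andP: w01.
    by move=> h; apply: lerXn2r; rewrite ?nnegrE ?one_sub_pp ?subr_ge0.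
  rewrite exprMn -one_sub_p one_sub_pX k1E yK1.
  have -> : expR (- (l - ln M)) = M / n%:R.
    by rewrite opprB expRD expRN -nE lnK ?posrE.
  rewrite ler_pM2l ?divr_gt0 //; apply: le_trans (@Bernoulli_le R w k.-1 w01).
  rewrite k1E lerD2l lerN2 ler_wpM2r //; first by case/andP: w01.
  lra.
have r_le1 : r <= 1 by rewrite exprn_ile1 ?subr_ge0 // gerBl.
have r_ge0 : 0 <= r by rewrite exprn_ge0 // subr_ge0.
apply: (@le_trans _ _ (expR (M - 3 * l) * expR (- r) ^+ (n - k.-1))).
  rewrite bin_pred_exp ler_wpM2l ?expR_ge0 //.
  by apply: lerXn2r; rewrite ?nnegrE ?expR_ge0 ?expR_ge1Dx // subr_ge0.
rewrite -expRM_natl -expRD natrB; last by rewrite (leq_trans (leq_pred k)).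
apply: (@le_trans _ _ (expR (1 - 3 * l))).
  rewrite ler_expR k1E.
  have h1 : (n%:R - K) * (M / n%:R * (1 - K * w)) <= (n%:R - (K - 1)) * r.
    have nK : 0 <= n%:R - K by rewrite subr_ge0 ler_nat.
    apply: (@le_trans _ _ ((n%:R - K) * r)); first by rewrite ler_wpM2l.
    by rewrite ler_wpM2r //; lra.
  have -> : M - 3 * l = (1 - 3 * l) + (M - 1) by ring.
  have h2 : M - 1 <= (n%:R - K) * (M / n%:R * (1 - K * w)).
    have -> : (n%:R - K) * (M / n%:R * (1 - K * w)) =
      M - (M * K / n%:R + M * K * w) + (M * K / n%:R) * (K * w).
      by field; apply: lt0r_neq0.
    have : 0 <= M * K / n%:R * (K * w).
      have [w0 _] := andP w01; apply: mulr_ge0; last exact: mulr_ge0.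
      by apply: divr_ge0 => //; apply: mulr_ge0 => //; apply: ltW.
    by have := K_n_w; lra.
  lra.
rewrite -[leLHS]invrK -expRN lef_pV2 ?posrE ?expR_gt0 //.
by apply: le_trans (expR_ge1Dx _); lraK.
Qed.

Let np_ge : 2 * l <= n%:R * p.
Proof.
rewrite /p /edge_prob; case: (lerP y 1) => y1.
  apply: (@le_trans _ _ (n%:R * (y / 2))); last first.
    by rewrite ler_wpM2l // one_sub_exp_ge // ltW.
  rewrite -(@ler_pM2r _ K); last lraK.
  have := k_le_n64; have := ler_wpM2l (ltW nR0) yK_ge; move=> h1 h2.
  have := ler_wpM2l (ltW l0) h2; have : 0 <= l * n%:R by rewrite mulr_ge0 // ltW.
  lra.
apply: (@le_trans _ _ (n%:R * 2^-1)); last by rewrite ler_wpM2l // one_sub_exp_ge1 // ltW.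
have := n_large; lraK.
Qed.

Let d : nat := (Num.truncn (4 * n%:R * pp)).+1.

Lemma Pr_large_degree :
  Pr pp (complete_graph n) (fun E => (d <= max_degree E)%N) <= l^-1.
Proof.
apply: le_trans (@Pr_max_degree n R pp _ d (ltn0Sn _)) _; first by rewrite pp0 pp1.
have d_ge : 4 * n%:R * pp <= d%:R by apply: ltW; apply: truncnS_gt.
have two_e : expR 2^-1 <= 2 :> R.
  have := @expR_sub1_le R 2^-1; move: (expR _) => z h.
  have {}h : z - 1 <= 2 * 2^-1 by apply: h; lra.
  lra.
apply: (@le_trans _ _ (expR (l + n%:R * pp) / expR (2 * n%:R * pp))).
  apply: ler_pM.
  - by apply: mulr_ge0 => //; apply: exprn_ge0; apply: addr_ge0.
  - by rewrite invr_ge0 exprn_ge0.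
  - rewrite expRD -nE ler_wpM2l // expRM_natl.
    by apply: lerXn2r; rewrite ?nnegrE ?expR_ge0 ?expR_ge1Dx // addr_ge0.
  rewrite lef_pV2 ?posrE ?expR_gt0 ?exprn_gt0 //.
  apply: (@le_trans _ _ (expR 2^-1 ^+ d)).
    by rewrite -expRM_natl ler_expR; lra.
  by apply: lerXn2r; rewrite ?nnegrE ?expR_ge0.
rewrite -expRB -[leLHS]invrK -expRN lef_pV2 ?posrE ?expR_gt0 //.
apply: le_trans (expR_ge1Dx _).
have : 0 <= n%:R * dp by rewrite mulr_ge0 // ltW.
have -> : - (l + n%:R * pp - 2 * n%:R * pp) = n%:R * p + n%:R * dp - l by rewrite /pp; ring.
by have := np_ge; lra.
Qed.

Let m_bounds : N * p + s <= m%:R /\ m%:R <= N * p + s + 1.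
Proof.
have h : 0 <= N * p + s.
  rewrite addr_ge0 // ?mulr_ge0 // ?(ltW l0) // ?(ltW N0) //.
  by case/andP: p_bounds => /ltW.
have /andP[h1 h2] := truncn_itv h.
by rewrite /m; split; [apply: ltW|rewrite -natr1 lerD2r].
Qed.

Let Npp : N * pp = N * p + 2 * s + 1.
Proof. by rewrite /pp /dp; field; apply: lt0r_neq0. Qed.

Let s0 : 0 < s. Proof. by rewrite mulr_gt0. Qed.

Lemma m_range : (0 < m <= 'C(n, 2))%N.
Proof.
rewrite /m /=; rewrite -(ler_nat R) -/m -/N.
have [_ h] := m_bounds; apply: le_trans h _.
apply: (@le_trans _ _ (N * pp)); last by rewrite ler_piMr // ltW.
rewrite Npp; have := s0; lra.
Qed.

Let Ns : N / s ^+ 2 <= l^-1.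
Proof.
have N_le : N <= n%:R ^+ 2 by have := twoN; have := sqr_ge0 (n%:R : R); rewrite expr2; have := nR0; lra.
rewrite ler_pdivrMr ?exprn_gt0 //.
have -> : l^-1 * s ^+ 2 = n%:R ^+ 2 * l by rewrite /s; field; apply: lt0r_neq0.
apply: le_trans N_le _; rewrite ler_peMr ?sqr_ge0 //; lraK.
Qed.

Let E1 : pred (edge_set n) := robustly_dominated k t.
Let E2 : pred (edge_set n) := predC (has_dominating k.-1).
Let E3 : pred (edge_set n) := fun E => (max_degree E < d)%N.

Let prob1 : 1 - 2 * l^-1 <= prob_gnm R m E1.
Proof.
have [m0 mN] := andP m_range; have [ml mu] := m_bounds.
apply: le_trans (@increasing_transfer R n p _ E1 m s mN s0 _ ml).
- by have := Pr_robust_ge; have := Ns; rewrite -/E1; lra.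
- by case/andP: p_bounds => /ltW -> /ltW ->.
- exact: increasing_robustly_dominated.
Qed.

Let m_le_pp : m%:R <= N * pp - s.
Proof. by have [_ mu] := m_bounds; rewrite Npp; lra. Qed.

Let prob2 : 1 - 2 * l^-1 <= prob_gnm R m E2.
Proof.
have [m0 mN] := andP m_range.
apply: le_trans (@decreasing_transfer R n pp _ E2 m s mN s0 _ m_le_pp).
- by rewrite /E2 Pr_predC; have := Pr_small_domination; have := Ns; lra.
- by rewrite pp0 pp1.
- move=> E E' EE' E'U /=; rewrite !negbK; exact: increasing_has_dominating.
Qed.

Let prob3 : 1 - 2 * l^-1 <= prob_gnm R m E3.
Proof.
have [m0 mN] := andP m_range.
apply: le_trans (@decreasing_transfer R n pp _ E3 m s mN s0 _ m_le_pp).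
- have -> : Pr pp (complete_graph n) E3 =
      Pr pp (complete_graph n) (predC (fun E => (d <= max_degree E)%N)).
    by apply: eq_Ex => E _; rewrite /E3 /= -ltnNge.
  by rewrite Pr_predC; have := Pr_large_degree; have := Ns; lra.
- by rewrite pp0 pp1.
- move=> E E' EE' E'U; rewrite /E3 /= -!leqNgt.
  exact: (@increasing_max_degree n d.-1 E E').
Qed.

Definition typical (mm : nat) (E : edge_set n) : bool :=
  [&& domination_number E == k,
      bondage_const eps * (max_degree E)%:R <= (bondage_number E)%:R
        <= (2 : R) * (max_degree E)%:R
    & (1 : R) * (mm%:R / n%:R) <= (max_degree E)%:R <= (48 : R) * (mm%:R / n%:R)].

Lemma typical_of_events E : E \in graphs_with n m -> E1 E -> E2 E -> E3 E -> typical m E.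
Proof.
rewrite inE => /andP[EU /eqP cE] e1 e2 e3.
have kltn : (k < n)%N by have := two_k_le; have := k_gt0; clear; lia.
have hk : has_dominating k E.
  move/forallP: (e1) => /(_ set0); rewrite cards0 leq0n /=; by rewrite setD0.
have domE : domination_number E = k.
  by apply: domination_numberE => //; rewrite k_gt0 ltnW.
have [ml mu] := m_bounds.
have deg_le : (max_degree E)%:R <= 4 * n%:R * p + 48 * l.
  have h : (max_degree E)%:R <= 4 * n%:R * pp.
    have h0 : 0 <= 4 * n%:R * pp by rewrite mulr_ge0 // mulr_ge0.
    apply: le_trans (_ : (Num.truncn (4 * n%:R * pp))%:R <= _).
      by rewrite ler_nat -ltnS.
    by rewrite truncn_le.
  apply: le_trans h _; have := ler_wpM2l (ltW nR0) dp_le.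
  have -> : n%:R * (12 * l / n%:R) = 12 * l by field; apply: lt0r_neq0.
  rewrite /pp; lra.
apply/and3P; split.
- by rewrite domE.
- apply/andP; split.
    apply: (@le_trans _ _ t%:R); last by rewrite ler_nat ltnW // (bondage_number_gt kltn domE).
    have K0 : 0 < K by lraK.
    rewrite -(@ler_pM2r _ K) //; apply: le_trans budget_ge.
    have deg_K : (max_degree E)%:R * K <= 56 * (n%:R * l).
      apply: (@le_trans _ _ ((4 * n%:R * p + 48 * l) * K)); first by rewrite ler_pM2r.
      have pK : p * K <= 2 * l.
        by have := y_le_lK; rewrite ler_pdivlMr //; have := p_le_y; move=> h1; apply: le_trans; rewrite ler_pM2r.
      have := ler_wpM2l (ltW nR0) pK; have : l * K <= l * n%:R by rewrite ler_wpM2l // ?ler_nat // ltW.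
      lra.
    have -> : n%:R * (rate * l) / 128 = bondage_const eps * (56 * (n%:R * l)).
      by rewrite /bondage_const -/rate; field.
    have bc0 : 0 <= bondage_const eps.
      by rewrite /bondage_const -/rate; apply: divr_ge0; [apply: ltW|apply: mulr_ge0].
    by rewrite -[leLHS]mulrA; apply: ler_wpM2l.
  rewrite -natrM ler_nat; apply: bondage_number_le => //.
  by rewrite cE.
- apply/andP; split.
    rewrite mul1r ler_pdivrMr // -natrM ler_nat mulnC -cE; exact: card_le_max_degree.
  apply: le_trans deg_le _; rewrite mulrA ler_pdivlMr //.
  have np0 : 0 <= n%:R * p by have := np_ge; have := l0; lra.
  have := twoN; have : n%:R * p * 100 <= n%:R * p * n%:R.
    by rewrite ler_wpM2l.
  move=> h1 h2; have h3 : 2 * (N * p) = n%:R * (n%:R - 1) * p by rewrite -h2; ring.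
  have : 48 * (N * p + s) <= 48 * m%:R by rewrite ler_pM2l.
  rewrite /s; lra.
Qed.

Lemma exists_edge_count : exists m : nat, (0 < m <= 'C(n, 2))%N /\
  1 - 6 / l <= prob_gnm R m (typical m).
Proof.
have [_ mN] := andP m_range; exists m; split; first exact: m_range.
have h12 := @prob_gnm_inter R n E1 E2 (predI E1 E2) m mN (fun E _ e1 e2 => introT andP (conj e1 e2)).
apply: le_trans (@prob_gnm_inter R n (predI E1 E2) E3 (typical m) m mN _); last first.
  by move=> E Em /andP[e1 e2] e3; apply: typical_of_events.
have := prob1; have := prob2; have := prob3; lra.
Qed.

End EdgeProbability.

Local Open Scope classical_set_scope.

Section Eventually.
Variable R : realType.

Lemma near_ln (L0 : R) : \forall n \near \oo, L0 <= ln n%:R.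
Proof.
exists (Num.truncn (expR L0)).+1 => // n /= hn.
have h : expR L0 <= n%:R.
  by apply: le_trans (_ : (Num.truncn (expR L0)).+1%:R <= _); rewrite ?ler_nat // ltW // truncnS_gt.
by rewrite -ler_expR lnK ?posrE // (lt_le_trans _ h) // expR_gt0.
Qed.

Lemma near_exp_ln (C a : R) j : 0 < a ->
  \forall n \near \oo, C * ln n%:R ^+ j <= expR (a * ln n%:R).
Proof.
move=> a0; near=> n.
have l0 : 0 <= ln n%:R :> R by near: n; apply: near_ln.
have lC : C * (j.+1)`!%:R / a ^+ j.+1 <= ln n%:R by near: n; apply: near_ln.
move: (ln _) l0 lC => l l0 lC.
have f0 : 0 < (j.+1)`!%:R :> R by rewrite ltr0n fact_gt0.
apply: (@le_trans _ _ ((a * l) ^+ j.+1 / (j.+1)`!%:R)); last first.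
  apply: le_trans (_ : 1 + (a * l) ^+ j.+1 / (j.+1)`!%:R <= _); first by rewrite lerDr.
  by apply: expR_ge1Dxn; rewrite mulr_ge0 // ltW.
rewrite ler_pdivlMr // exprMn.
have aj : 0 < a ^+ j.+1 by rewrite exprn_gt0.
rewrite ler_pdivrMr // in lC.
have -> : C * l ^+ j * (j.+1)`!%:R = l ^+ j * (C * (j.+1)`!%:R) by rewrite mulrAC mulrC.
have -> : a ^+ j.+1 * l ^+ j.+1 = l ^+ j * (l * a ^+ j.+1).
  by rewrite [l ^+ j.+1]exprSr mulrCA [a ^+ _ * l]mulrC.
by rewrite ler_wpM2l ?exprn_ge0.
Unshelve. all: by end_near.
Qed.

Lemma prob_gnm_le1 n m (P : pred (edge_set n)) : prob_gnm R m P <= 1.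
Proof.
rewrite /prob_gnm; case: (posnP #|graphs_with n m|) => [->|G0].
  by rewrite invr0 mulr0.
rewrite ler_pdivrMr ?ltr0n // mul1r ler_nat; apply/subset_leq_card/subsetP => E.
by rewrite inE => /andP[].
Qed.

End Eventually.

Theorem theorem2p1 (R : realType) (eps : R) (k : nat -> int)
  (eps_gt0 : 0 < eps)
  (k_range : \forall n \near \oo,
     eps * ln n%:R <= (k n)%:~R <= n%:R `^ (3^-1 - eps)) :
  exists m : nat -> nat,
    (\forall n \near \oo, (0 < m n <= 'C(n, 2))%N) /\
    exists c1 C1 c2 C2 : R,
      [/\ 0 < c1, 0 < C1, 0 < c2, 0 < C2 &
        aas R m (fun n (E : edge_set n) =>
          [&& (domination_number E)%:Z == k n,
              c1 * (max_degree E)%:R <= (bondage_number E)%:R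
                <= C1 * (max_degree E)%:R
            & c2 * ((m n)%:R / n%:R) <= (max_degree E)%:R
                <= C2 * ((m n)%:R / n%:R)])].
Proof.
pose Th : R := expR (2 / eps).
pose l n : R := ln n%:R.
pose rate := sparse_rate eps.
pose event n m : pred (edge_set n) := fun E =>
  [&& (domination_number E)%:Z == k n,
      bondage_const eps * (max_degree E)%:R <= (bondage_number E)%:R
        <= (2 : R) * (max_degree E)%:R
    & (1 : R) * (m%:R / n%:R) <= (max_degree E)%:R <= (48 : R) * (m%:R / n%:R)].
pose good n m := (0 < m <= 'C(n, 2))%N /\ 1 - 6 / l n <= prob_gnm R m (event n m).
have near_l L0 : \forall n \near \oo, L0 <= l n by apply: near_ln.
have near_exp C a j : 0 < a -> \forall n \near \oo, C * l n ^+ j <= expR (a * l n).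
  exact: near_exp_ln.
have near_epsl L0 : \forall n \near \oo, L0 <= eps * l n.
  near=> n; rewrite -ler_pdivrMl //; near: n; exact: near_l.
have k_nat : \forall n \near \oo, [/\ 100 <= eps * l n, 100 <= l n,
    k n = `|k n|%N :> int, eps * l n <= `|k n|%N%:R
    & `|k n|%N%:R <= expR ((3^-1 - eps) * l n)].
  near=> n.
  have e100 : 100 <= eps * l n by near: n; apply: near_epsl.
  have l100 : 100 <= l n by near: n; apply: near_l.
  have /andP[k1 k2] : eps * ln n%:R <= (k n)%:~R <= n%:R `^ (3^-1 - eps).
    by near: n; exact: k_range.
  have kE : k n = `|k n|%N :> int.
    by rewrite gez0_abs // -(ler0z R) (le_trans _ k1) // (le_trans _ e100).
  rewrite kE in k1 k2; split=> //; apply: le_trans k2 _.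
  rewrite /powR; case: eqP => // n0.
  by move: l100; rewrite /l n0 ln0 //; lra.
have eps3 : eps < 3^-1.
  have [n [e100 l100 _ k1 k2]] := filter_ex k_nat.
  exact: (eps_lt (n := n) (k := `|k n|%N)).
have rate0 := sparse_rate_gt0 eps_gt0 eps3.
have good_near : \forall n \near \oo, exists m, good n m.
  near=> n.
  have [e100 l100 kE k1 k2] : [/\ 100 <= eps * l n, 100 <= l n,
    k n = `|k n|%N :> int, eps * l n <= `|k n|%N%:R
    & `|k n|%N%:R <= expR ((3^-1 - eps) * l n)] by near: n; exact: k_nat.
  have lTh : 2 * Th <= l n by near: n; apply: near_l.
  have x1 : 2 * l n <= expR (eps * l n).
    by near: n; apply: (near_exp 2 eps 1%N).
  have x2 : 72 * l n <= expR (24^-1 * l n).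
    by near: n; apply: (near_exp 72 _ 1%N).
  have x3 : 9 * expR (2^-1 / eps) * l n ^+ 0 <= expR (12^-1 * l n).
    by near: n; apply: near_exp.
  rewrite expr0 mulr1 in x3.
  have x4 : 24 * Th * l n <= expR (3^-1 * l n).
    by near: n; apply: (near_exp (24 * Th) _ 1%N).
  have rl : 2 <= rate * l n.
    by rewrite -ler_pdivrMl //; near: n; apply: near_l.
  have x5 : 64 * (16 * 37 + 80 * rate) * Th * l n ^+ 4 <= expR (2 * eps * l n).
    by near: n; apply: near_exp; rewrite mulr_gt0.
  have [m [m_range pm]] := exists_edge_count eps_gt0 k1 k2 l100 e100 lTh x1 x2 x3 x4 rl x5.
  exists m; split=> //; apply: le_trans pm _.
  rewrite /prob_gnm ler_wpM2r ?invr_ge0 // ler_nat; apply/subset_leq_card/subsetP => E.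
  by rewrite !inE => /andP[-> /and3P[/eqP dE b1 b2]]; rewrite /event kE dE eqxx b1 b2.
have [m mP] : {m : nat -> nat & forall n, (exists m0, good n m0) -> good n (m n)}.
  apply: (boolp.choice (P := fun n m => (exists m0, good n m0) -> good n m)) => n; case: (pselect (exists m0, good n m0)) => [[m0 hm]|h].
    by exists m0.
  by exists 0%N.
exists m; split.
  near=> n; have /mP[] // : exists m0, good n m0 by near: n; exact: good_near.
exists (bondage_const eps), 2, 1, 48; split=> //.
  by rewrite /bondage_const divr_gt0 // mulr_gt0.
rewrite /aas; apply/cvgrPdist_le => /= e e0; near=> n.
have [_ hp] : good n (m n) by apply: mP; near: n; exact: good_near.
have le1 := prob_gnm_le1 R (m n) (event n (m n)).
rewrite ger0_norm ?subr_ge0 //.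
have l6 : 6 / e <= l n by near: n; apply: near_l.
have l0 : 0 < l n by apply: lt_le_trans l6; rewrite divr_gt0.
have : 6 / l n <= e by rewrite ler_pdivrMr // mulrC -ler_pdivrMr.
rewrite -/(event n (m n)); lra.
Unshelve. all: by end_near.
Qed.
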